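(* For every $\varepsilon>0$, the following holds for each $R\ge R_0(\varepsilon)$ sufficiently large and each $R^\varepsilon\le\rho\le R^{1/2}$. There is a random set $X\subset[0,R]^3$ such that, with probability at least $0.9$: $X$ has cardinality $\sim R^{3+\varepsilon}\rho^{-3}$; every $\rho$-cube contains at most $R^\varepsilon$ points of $X$; and every $1\times R^{1/2}\times R$-lightplank $P$ in a maximal pairwise incomparable collection $\mathcal P$ of such lightplanks contained in $[0,R]^3$ contains $\sim R^{3/2+\varepsilon}\rho^{-3}$ points of $X$. In particular, $$(R^{3/2+\varepsilon}\rho^{-3})^{4/3}|\mathcal P|\gtrapprox|X|^{4/3}.$$
   Context: Lightplanks: let $\gamma(\theta)=\frac1{\sqrt2}(\cos\theta,\sin\theta,1)$ for $\theta\in[-\pi,\pi)$. For $A,B>0$, an $A\times\sqrt{AB}\times B$-lightplank with center $v\in\mathbb R^3$ is a set of the form $$P=v+\{a\gamma(\theta_P)+b\gamma'(\theta_P)+c(\gamma\times\gamma')(\theta_P):|a|\le \tfrac A2,\ |b|\le\tfrac{\sqrt{AB}}2,\ |c|\le\tfrac B2\}$$ for some $\theta_P\in[-\pi,\pi)$. Here $A=1$, $B=R$. Two such lightplanks are ($K$-)incomparable if neither is contained in the $K$-dilation of the other about its center, where $K>1$ is a fixed constant; a collection is pairwise incomparable if any two distinct members are incomparable. A $\rho$-cube is a cube of side length $\rho$. $A\sim B$ means $C^{-1}B\le A\le CB$ for an absolute constant $C$. $A\gtrapprox B$ means that for every $\eta>0$ there is a constant $C_\eta$ (independent of $R$) with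 $B\le C_\eta R^{\eta}A$. $|\cdot|$ of a finite set is its cardinality. *)

(* Defs.v *)
From HB Require Import structures.
From mathcomp Require Import all_boot all_order all_algebra finmap.
From mathcomp Require Import all_classical all_reals all_analysis.

Set Implicit Arguments.
Unset Strict Implicit.
Unset Printing Implicit Defensive.

Import Order.TTheory GRing.Theory Num.Theory.
Import numFieldNormedType.Exports.

Local Open Scope classical_set_scope.
Local Open Scope ring_scope.

Definition vec3 {R : realType} (a b c : R) : 'rV[R]_3 :=
  \row_j [:: a; b; c]`_j.

Definition crossprod {R : realType} (u v : 'rV[R]_3) : 'rV[R]_3 :=
  let u_ i := u 0 (inord i) in let v_ i := v 0 (inord i) in
  vec3 (u_ 1%N * v_ 2%N - u_ 2%N * v_ 1%N)
       (u_ 2%N * v_ 0%N - u_ 0%N * v_ 2%N)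
       (u_ 0%N * v_ 1%N - u_ 1%N * v_ 0%N).

Definition gamma {R : realType} (t : R) : 'rV[R]_3 :=
  (Num.sqrt 2)^-1 *: vec3 (cos t) (sin t) 1.

(* A lightplank of dimensions A x sqrt(AB) x B is encoded by the pair
   (center, angle).  Two different pairs could in principle describe the same
   set, but then they are comparable in the sense below, so that the members of
   a pairwise incomparable collection of pairs are different as sets. *)
Definition lightplank {R : realType} (A B : R) (p : 'rV[R]_3 * R) :
    set 'rV[R]_3 :=
  [set x | exists a b c : R,
    [/\ `|a| <= A / 2, `|b| <= Num.sqrt (A * B) / 2, `|c| <= B / 2 &
        x = p.1 + (a *: gamma p.2 + b *: derive1 gamma p.2 +
                   c *: crossprod (gamma p.2) (derive1 gamma p.2))]].

Definition dilate {R : realType} (K : R) (v : 'rV[R]_3) (S : set 'rV[R]_3) :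
    set 'rV[R]_3 :=
  [set v + K *: (x - v) | x in S].

Definition incomparable {R : realType} (K A B : R) (p q : 'rV[R]_3 * R) :
    Prop :=
  ~ (lightplank A B p `<=` dilate K q.1 (lightplank A B q)) /\
  ~ (lightplank A B q `<=` dilate K p.1 (lightplank A B p)).

Definition box {R : realType} (r : R) : set 'rV[R]_3 :=
  [set x | forall i, 0 <= x 0 i <= r].

Definition lightplanks_in_box {R : realType} (r : R) : set ('rV[R]_3 * R) :=
  [set p | - pi <= p.2 < pi /\ lightplank 1 r p `<=` box r].

Definition pairwise_incomparable {R : realType} (K r : R)
    (PP : set ('rV[R]_3 * R)) : Prop :=
  PP `<=` lightplanks_in_box r /\
  forall p q, PP p -> PP q -> p <> q -> incomparable K 1 r p q.

Definition maximal_incomparable {R : realType} (K r : R)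
    (PP : set ('rV[R]_3 * R)) : Prop :=
  pairwise_incomparable K r PP /\
  forall QQ, pairwise_incomparable K r QQ -> PP `<=` QQ -> QQ = PP.

(* The cube has a vertex at [v], and its edges are directed along the rows of
   the orthogonal matrix [M]: it need not be parallel to the axes. *)
Definition is_cube {R : realType} (rho : R) (Q : set 'rV[R]_3) : Prop :=
  exists (v : 'rV[R]_3) (M : 'M[R]_3),
    M *m M^T = 1%:M /\
    Q = [set v + t *m M | t in box rho].

Definition npoints {R : realType} (X : {fset 'rV[R]_3}) (B : set 'rV[R]_3) :
    nat :=
  #|` [fset x in X | x \in B]%fset |.

(* Finite random sets are simple point processes: the number of points in each
   Borel set is a random variable. *)
Definition random_set {R : realType} d (Omega : measurableType d)
    (X : Omega -> {fset 'rV[R]_3}) : Prop :=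
  forall B : set 'rV[R]_3, <<s open >> B ->
  forall k : nat, measurable [set w | npoints (X w) B = k].

Definition comparable_up_to {R : realType} (C a b : R) : Prop :=
  C^-1 * b <= a <= C * b.

(* [G] may involve uncountably many conditions, so it is only required to
   contain a measurable event of probability at least [p]. *)
Definition with_prob_at_least {R : realType} d (Omega : measurableType d)
    (P : probability Omega R) (p : R) (G : set Omega) : Prop :=
  exists E : set Omega, [/\ measurable E, (p%:E <= P E)%E & E `<=` G].

(* Main.v *)
Require Import Defs.
From HB Require Import structures.
From mathcomp Require Import all_boot all_order all_algebra finmap.
From mathcomp Require Import all_classical all_reals all_analysis.
From mathcomp Require Import ring lra.
Import Order.TTheory GRing.Theory Num.Theory.
Import numFieldNormedType.Exports.
Local Open Scope classical_set_scope.
Local Open Scope ring_scope.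

Set Implicit Arguments.
Unset Strict Implicit.
Unset Printing Implicit Defensive.

(* The random set may be taken constant, because a single good set is produced
   by the probabilistic method.  Cut [0, r]^3 into n^3 cells of side s, with s
   comparable to rho r^(-eps/3), and put one point in each cell, on a fixed
   vertical edge, at a height chosen uniformly and independently in a fine finite
   set.  The bounds on the cardinality and on the rho-cubes then hold for every
   choice.  The normal of a plank has vertical component 1/sqrt 2 and its
   thickness is 1, so each vertical line meets it in a segment of bounded length:
   slicing shows that the expected number of points in a plank is comparable to
   its volume over s^3, which is at least a constant times r^eps.  Exponential
   moments make deviations by a constant factor have probability
   exp(- c r^eps), and up to a constant dilation there are only polynomially many
   planks, so some choice works for all of them at once.

   For the last inequality one needs |PP| >= c r^2.  Two comparable planks have
   directions within O(r^(-1/2)) and centers that differ by O(1) in the short and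
   O(r^(1/2)) in the middle direction; an explicit family of about r^2 planks
   separated by more than this is therefore mapped injectively into PP by
   choosing a comparable member. *)

(** * Planks in coordinates *)

Definition entry {R : realType} (x : 'rV[R]_3) (i : nat) : R := x 0 (inord i).

Lemma vec3E {R : realType} (a b c : R) :
  [/\ entry (vec3 a b c) 0 = a, entry (vec3 a b c) 1 = b
    & entry (vec3 a b c) 2 = c].
Proof. by rewrite /entry /vec3 !mxE !inordK. Qed.

Lemma entry_eq {R : realType} (x y : 'rV[R]_3) :
  entry x 0 = entry y 0 -> entry x 1 = entry y 1 -> entry x 2 = entry y 2 ->
  x = y.
Proof.
move=> h0 h1 h2; apply/rowP => -[[|[|[|//]]] hi].
- by move: h0; rewrite /entry (_ : inord 0 = Ordinal hi)//; apply/val_inj; rewrite /= inordK.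
- by move: h1; rewrite /entry (_ : inord 1 = Ordinal hi)//; apply/val_inj; rewrite /= inordK.
- by move: h2; rewrite /entry (_ : inord 2 = Ordinal hi)//; apply/val_inj; rewrite /= inordK.
Qed.

Lemma entryD {R : realType} (x y : 'rV[R]_3) i :
  entry (x + y) i = entry x i + entry y i.
Proof. by rewrite /entry mxE. Qed.

Lemma entryB {R : realType} (x y : 'rV[R]_3) i :
  entry (x - y) i = entry x i - entry y i.
Proof. by rewrite /entry !mxE. Qed.

Lemma entryZ {R : realType} (a : R) (x : 'rV[R]_3) i :
  entry (a *: x) i = a * entry x i.
Proof. by rewrite /entry mxE. Qed.

Lemma derive1_gamma {R : realType} (t : R) :
  derive1 gamma t = (Num.sqrt 2)^-1 *: vec3 (- sin t) (cos t) 0.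
Proof.
have dk (i : 'I_1) (j : 'I_3) : is_derive t 1 (fun u : R => gamma u i j)
    (((Num.sqrt 2)^-1 *: vec3 (- sin t) (cos t) 0) 0 j).
  case: j => -[|[|[|//]]] hj; rewrite !mxE /=;
      [set f := @cos R | set f := @sin R | set f : R -> R := cst 1];
    (rewrite (_ : (fun _ => _) = (Num.sqrt 2)^-1 \*: f);
      last by apply/funext => u; rewrite !mxE);
    exact: is_deriveZ.
rewrite derive1E derive_mx; first by apply/rowP => j; rewrite mxE derive_val.
by apply/derivable_mxP => i j; case: (dk i j).
Qed.

Lemma crossprodE {R : realType} (u v : 'rV[R]_3) :
  [/\ entry (crossprod u v) 0 = entry u 1 * entry v 2 - entry u 2 * entry v 1,
      entry (crossprod u v) 1 = entry u 2 * entry v 0 - entry u 0 * entry v 2 &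
      entry (crossprod u v) 2 = entry u 0 * entry v 1 - entry u 1 * entry v 0].
Proof. exact: vec3E. Qed.

(* For a plank of angle t and (p, q) = (cos t, sin t), a displacement with
   component al along (p, q) and height z has coefficient (al + z) / sqrt 2 along
   gamma and z - al along the cross product of gamma and gamma'. *)
Definition slabs {R : realType} (p q r sigma x y z : R) : Prop :=
  [/\ `|p * x + q * y + z| <= sigma / Num.sqrt 2,
      `|p * y - q * x| <= sigma * Num.sqrt r / (2 * Num.sqrt 2) &
      `|z - (p * x + q * y)| <= sigma * r / 2].

(** The frame is orthogonal but not orthonormal: [gamma] is a unit vector, its derivative has length
    1 / sqrt 2, and the cross product is (- cos t, - sin t, 1) / 2, again of length 1 / sqrt 2. *)
Lemma frame_coords {R : realType} (t a b c : R) (i := @Num.sqrt R 2) :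
  let w := a *: gamma t + b *: derive1 gamma t +
           c *: crossprod (gamma t) (derive1 gamma t) in
  [/\ entry w 0 = (a * cos t - b * sin t) / i - c * cos t / 2,
      entry w 1 = (a * sin t + b * cos t) / i - c * sin t / 2 &
      entry w 2 = a / i + c / 2].
Proof.
have i2 : i ^+ 2 = 2 by rewrite sqr_sqrtr.
have i0 : i != 0 by rewrite sqrtr_eq0 -ltNge.
have cs := cos2Dsin2 t.
have [g0 g1 g2] := vec3E (cos t) (sin t) 1.
have [h0 h1 h2] := vec3E (- sin t) (cos t) 0.
have [k0 k1 k2] := crossprodE (gamma t) (derive1 gamma t).
rewrite /= !entryD !entryZ k0 k1 k2 derive1_gamma !entryZ.
rewrite g0 g1 g2 h0 h1 h2 -/i.
have jj : i^-1 * i^-1 = 1 / 2 by rewrite -invfM -expr2 i2 mul1r.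
split.
- transitivity ((a * cos t - b * sin t) / i - c * cos t * (i^-1 * i^-1)).
    ring.
  by rewrite jj; ring.
- transitivity ((a * sin t + b * cos t) / i - c * sin t * (i^-1 * i^-1)).
    ring.
  by rewrite jj; ring.
- transitivity (a / i + c * (i^-1 * i^-1) * (cos t ^+ 2 + sin t ^+ 2)).
    ring.
  by rewrite jj cs; ring.
Qed.

Lemma lightplankP {R : realType} (r t : R) (v x : 'rV[R]_3) : 0 < r ->
  lightplank 1 r (v, t) x <->
  slabs (cos t) (sin t) r 1 (entry x 0 - entry v 0) (entry x 1 - entry v 1)
    (entry x 2 - entry v 2).
Proof.
move=> r0; set i := @Num.sqrt R 2.
have i0 : 0 < i by rewrite sqrtr_gt0.
have jj : i^-1 * i^-1 = 1 / 2.
  by rewrite -invfM -expr2 sqr_sqrtr// mul1r.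
have ii : i^-1 * i = 1 by rewrite mulVf// gt_eqF.
have j0 : 0 < i^-1 by rewrite invr_gt0.
have jE : i = 2 * i^-1.
  transitivity (2 * (i^-1 * i^-1) * i); first by rewrite jj; field.
  by rewrite -!mulrA ii mulr1.
have cs := cos2Dsin2 t.
rewrite /lightplank /slabs /= !mul1r -/i invfM.
set u := i^-1 in jj ii j0 jE *.
split=> [[a [b [c [ha hb hc ->]]]]|[ha hb hc]].
  have [w0 w1 w2] := frame_coords t a b c.
  rewrite /= in w0 w1 w2.
  set w := a *: _ + _ + _ in w0 w1 w2 *.
  clearbody w; rewrite !entryD w0 w1 w2 -/i -/u; clear w w0 w1 w2.
  set v0 := entry v 0; set v1 := entry v 1; set v2 := entry v 2.
  split.
  - rewrite (_ : _ + _ = u * (2 * a)); last first.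
      transitivity (u * a * (cos t ^+ 2 + sin t ^+ 2 + 1)
        + c / 2 * (1 - (cos t ^+ 2 + sin t ^+ 2))); first ring.
      by rewrite cs; ring.
    by rewrite normrM gtr0_norm// -[leRHS]mulr1 ler_pM2l//; move: ha; rewrite !ler_norml; lra.
  - rewrite (_ : _ - _ = u * b); last first.
      transitivity (u * b * (cos t ^+ 2 + sin t ^+ 2)); first ring.
      by rewrite cs; ring.
    rewrite normrM gtr0_norm//; have := ler_wpM2l (ltW j0) hb. lra.
  - rewrite (_ : _ - _ = c); last first.
      transitivity (u * a * (1 - (cos t ^+ 2 + sin t ^+ 2))
        + c / 2 * (1 + (cos t ^+ 2 + sin t ^+ 2))); first ring.
      by rewrite cs; field.
    by lra.
set x0 := entry x 0 - entry v 0 in ha hb hc.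
set x1 := entry x 1 - entry v 1 in ha hb hc.
set x2 := entry x 2 - entry v 2 in ha hb hc.
pose al := cos t * x0 + sin t * x1; pose be := cos t * x1 - sin t * x0.
rewrite -/al -/be in ha hb hc.
(* Each witness is the inner product of the displacement with a frame vector, divided by the squared
   length of that vector. *)
exists (u * (al + x2)), (i * be), (x2 - al).
have [w0 w1 w2] := frame_coords t (u * (al + x2)) (i * be) (x2 - al).
rewrite /= in w0 w1 w2.
set w := _ *: _ + _ + _ in w0 w1 w2 *.
clearbody w; rewrite -/i -/u in w0 w1 w2.
split => //.
- rewrite normrM gtr0_norm//; have := ler_wpM2l (ltW j0) ha.
  by rewrite jj; lra.
- rewrite normrM gtr0_norm//; have := ler_wpM2l (ltW i0) hb.
  rewrite [leRHS](_ : _ = (u * i) * (Num.sqrt r / 2)); last by field.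
  by rewrite ii mul1r.
- apply: entry_eq; rewrite entryD ?w0 ?w1 ?w2.
  + transitivity (entry v 0 + (u * u) * cos t * (al + x2) - (u * i) * sin t * be
      - (x2 - al) * cos t / 2); last ring.
    rewrite jj ii. 
    transitivity (entry v 0 + x0 * (cos t ^+ 2 + sin t ^+ 2)).
      by rewrite cs /x0; ring.
    by rewrite /al /be; field.
  + transitivity (entry v 1 + (u * u) * sin t * (al + x2) + (u * i) * cos t * be
      - (x2 - al) * sin t / 2); last ring.
    rewrite jj ii. 
    transitivity (entry v 1 + x1 * (cos t ^+ 2 + sin t ^+ 2)).
      by rewrite cs /x1; ring.
    by rewrite /al /be; field.
  + transitivity (entry v 2 + (u * u) * (al + x2) + (x2 - al) / 2); last ring.
    by rewrite jj /x2; field.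
Qed.

(** Rational bounds keep the later estimates within reach of linear arithmetic. *)
Lemma inv_sqrt2_bounds {R : realType} :
  (7 / 10) <= (@Num.sqrt R 2)^-1 <= (18 / 25).
Proof.
set i := Num.sqrt 2.
have i0 : 0 < i by rewrite sqrtr_gt0.
have ii : i * i = 2 by rewrite -expr2 sqr_sqrtr.
have ui : i^-1 * i = 1 by rewrite mulVf// gt_eqF.
have lo : (7 / 5) <= i by nra.
have hi : i <= (71 / 50) by nra.
have u0 : 0 < i^-1 by rewrite invr_gt0.
by apply/andP; split; nra.
Qed.

Lemma slabsZ {R : realType} (k p q r sigma x y z : R) : 0 < k ->
  slabs p q r sigma x y z <->
  slabs p q r (k * sigma) (k * x) (k * y) (k * z).
Proof.
move=> k0.
have E1 : p * (k * x) + q * (k * y) = k * (p * x + q * y) by ring.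
have E2 : p * (k * y) - q * (k * x) = k * (p * y - q * x) by ring.
rewrite /slabs E1 E2 -mulrDr -mulrBr !normrM (gtr0_norm k0) -!(mulrA k).
by rewrite !ler_pM2l.
Qed.

Lemma slabs_swap {R : realType} (p q r sigma x y z : R) :
  slabs p q r sigma x y z -> slabs q p r sigma y x z.
Proof.
by rewrite /slabs => -[h1 h2 h3]; split;
  rewrite ?(addrC (q * y))// distrC.
Qed.

Lemma slabs_mono {R : realType} (p q r s1 s2 x y z : R) : 0 <= r -> s1 <= s2 ->
  slabs p q r s1 x y z -> slabs p q r s2 x y z.
Proof.
move=> r0 s12 [h1 h2 h3]; have /andP[u1 u2] := @inv_sqrt2_bounds R.
split; first by apply: le_trans h1 _; move: s12 u1; clear; nra.
  apply: le_trans h2 _; rewrite invfM.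
  have := sqrtr_ge0 r => ?.
  suff : 0 <= (s2 - s1) * (Num.sqrt r * (2^-1 / Num.sqrt 2)) by nra.
  by rewrite mulr_ge0 ?subr_ge0// mulr_ge0// mulr_ge0//; lra.
by apply: le_trans h3 _; nra.
Qed.

(** An error [tau] in the direction is multiplied by coordinates of size up to [r], so the outer
    forms change by at most 5 tau r and the middle one by 4 tau r. Widening gains at least (s2 - s1)
    / 2 in the outer slabs and 7/20 (s2 - s1) in the middle one; the factor 12 covers all three. *)
Lemma slabs_close {R : realType} (p q p' q' r s1 s2 tau x y z x' y' z' : R) :
  1 <= r -> `|p'| <= 1 -> `|q'| <= 1 ->
  `|p - p'| <= tau -> `|q - q'| <= tau ->
  `|x - x'| <= tau -> `|y - y'| <= tau -> `|z - z'| <= tau ->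
  `|x| <= r -> `|y| <= r -> 12 * tau * r <= s2 - s1 ->
  slabs p q r s1 x y z -> slabs p' q' r s2 x' y' z'.
Proof.
move=> r1 p1 q1 pp qq xx yy zz xr yr ts [h1 h2 h3].
have /andP[u1 u2] := @inv_sqrt2_bounds R.
have tau0 : 0 <= tau by apply: le_trans pp.
have sr1 : 1 <= Num.sqrt r by rewrite -sqrtr1 ler_wsqrtr.
have bnd (e a b : R) : `|a| <= e -> `|b| <= r -> `|a * b| <= e * r.
  by move=> *; rewrite normrM ler_pM.
have bn1 (a b : R) : `|a| <= 1 -> `|b| <= tau -> `|a * b| <= tau.
  by move=> ? ?; rewrite normrM -[leRHS]mul1r ler_pM.
have tri (a a' A B d : R) : `|a| <= A -> `|a' - a| <= d -> A + d <= B ->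
    `|a'| <= B by clear; rewrite !ler_norml; lra.
have tr : tau <= tau * r by rewrite ler_peMr.
have s0 : 12 * (tau * r) <= s2 - s1 by rewrite mulrA.
have := bn1 _ _ q1 xx; have := bn1 _ _ p1 yy.
have := bnd _ _ _ qq xr; have := bnd _ _ _ pp yr.
have := bn1 _ _ q1 yy; have := bn1 _ _ p1 xx.
have := bnd _ _ _ qq yr; have := bnd _ _ _ pp xr.
move: h1 h2 h3 zz tau0 tr sr1 u1 u2 s0; set T := tau * r.
clear ts bnd bn1 p1 q1 xr yr pp qq xx yy.
set sr := Num.sqrt r; set u := (Num.sqrt 2)^-1.
move=> h1 h2 h3 zz tau0 tr sr1 u1 u2 s0 A1 A2 A3 A4 B1 B2 B3 B4.
have e1 : `|(p' * x' + q' * y') - (p * x + q * y)| <= 4 * T.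
  rewrite (_ : _ - _ = - ((p - p') * x) - (q - q') * y - p' * (x - x')
     - q' * (y - y')); last by ring.
  by move: A1 A2 A3 A4 tr; clear; rewrite !ler_norml; lra.
have e2 : `|(p' * y' - q' * x') - (p * y - q * x)| <= 4 * T.
  rewrite (_ : _ - _ = - ((p - p') * y) + (q - q') * x - p' * (y - y')
     + q' * (x - x')); last by ring.
  by move: B1 B2 B3 B4 tr; clear; rewrite !ler_norml; lra.
have s00 : 0 <= s2 - s1 by apply: le_trans s0; move: tau0 tr; clear; lra.
clear A1 A2 A3 A4 B1 B2 B3 B4.
rewrite /slabs -/u -/sr; split.
- apply: tri h1 (_ : _ <= 5 * T) _.
    by move: e1 zz tr; clear; rewrite !ler_norml; lra.
  by have := ler_wpM2l s00 u1; move: s0 tr tau0; clear; lra.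
- apply: tri h2 e2 _; rewrite invfM -/u.
  have : (s2 - s1) * (7 / 20) <= (s2 - s1) * (sr * (2^-1 * u)).
    apply: ler_wpM2l => //.
    have : 1 * (7 / 10) <= sr * u by apply: ler_pM => //; clear; lra.
    by clear; lra.
  by move: s0 tr tau0; clear; lra.
- apply: tri h3 (_ : _ <= 5 * T) _.
    by move: e1 zz tr; clear; rewrite !ler_norml; lra.
  have : (s2 - s1) * 1 <= (s2 - s1) * r.
    by apply: ler_wpM2l.
  by move: s0 tr tau0; clear; lra.
Qed.

(** * Planks between two regions fibred over a horizontal axis *)

Lemma larger_cos {R : realType} (p q : R) : p ^+ 2 + q ^+ 2 = 1 ->
  `|q| <= `|p| -> [/\ (7 / 10) <= `|p|, `|p| <= 1 & `|q| <= 1].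
Proof.
move=> pq qp; rewrite -(real_normK (num_real p)) -(real_normK (num_real q)) in pq.
have := normr_ge0 q; have := normr_ge0 p => p0 q0.
split; nra.
Qed.

(* The largest of |p| and |q| is bounded below, so dividing by it is harmless;
   the other case follows by exchanging the horizontal axes. *)
Lemma slabs_half_graph {R : realType} (p q r x y z : R) :
  p ^+ 2 + q ^+ 2 = 1 -> `|q| <= `|p| -> 16 <= Num.sqrt r ->
  `|x| <= r / 64 -> `|y - q / p * x| <= Num.sqrt r / 8 ->
  `|z - - (p * x + q * y)| <= 1 / 4 -> slabs p q r (1 / 2) x y z.
Proof.
move=> pq qp r16 hx hy hz.
have [p7 p1 q1] := larger_cos pq qp.
have p0 : p != 0 by rewrite -normr_gt0; lra.
have /andP[u1 u2] := @inv_sqrt2_bounds R.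
have r0 : 0 <= r by case: (lerP 0 r) => // r0; move: r16; rewrite ltr0_sqrtr//; lra.
have rr : r = Num.sqrt r * Num.sqrt r by rewrite -expr2 sqr_sqrtr.
set sr := Num.sqrt r in r16 hy rr *.
rewrite opprK in hz.
have hb : `|p * y - q * x| <= sr / 8.
  rewrite (_ : p * y - q * x = p * (y - q / p * x)); last by field.
  rewrite normrM -[leRHS]mul1r; apply: ler_pM => //.
have ha : `|p * x + q * y| <= (1 / 25) * r.
  have : `|p * (p * x + q * y)| <= r / 64 + sr / 8.
    rewrite (_ : p * _ = (p ^+ 2 + q ^+ 2) * x + q * (p * y - q * x)); last by ring.
    rewrite pq mul1r; apply: le_trans (ler_normD _ _) _; apply: lerD => //.
    by rewrite normrM -[leRHS]mul1r; apply: ler_pM.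
  rewrite normrM; have := normr_ge0 (p * x + q * y).
  nra.
rewrite /slabs -/sr; split.
- by rewrite addrC; move: hz u1; clear; lra.
- by apply: le_trans hb _; rewrite invfM; move: u1 r16; clear; nra.
- by move: ha hz r16 rr; clear; rewrite !ler_norml; nra.
Qed.

(** This is the outer region: its fibres have the same shape as the inner ones, with widths larger
    by constant factors, so upper and lower counts agree up to a constant. *)
Lemma slabs_two_graph {R : realType} (p q r x y z : R) :
  p ^+ 2 + q ^+ 2 = 1 -> `|q| <= `|p| -> 16 <= Num.sqrt r ->
  slabs p q r 2 x y z ->
  [/\ `|x| <= r, `|y - q / p * x| <= 2 * Num.sqrt r &
  `|z - - (p * x + q * y)| <= 2].
Proof.
move=> pq qp r16 [h1 h2 h3].
have [p7 p1 q1] := larger_cos pq qp.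
have p0 : p != 0 by rewrite -normr_gt0; lra.
have /andP[u1 u2] := @inv_sqrt2_bounds R.
have r0 : 0 <= r by case: (lerP 0 r) => // r0; move: r16; rewrite ltr0_sqrtr//; lra.
have rr : r = Num.sqrt r * Num.sqrt r by rewrite -expr2 sqr_sqrtr.
set sr := Num.sqrt r in r16 h2 rr *.
rewrite invfM in h2.
have hb : `|p * y - q * x| <= (18 / 25) * sr 
  by apply: le_trans h2 _; move: u2 r16; clear; nra.
have h1' : `|p * x + q * y + z| <= (36 / 25) by lra.
have ha : `|p * x + q * y| <= r / 2 + (18 / 25).
  by move: h1' h3; rewrite !ler_norml; lra.
split.
- rewrite (_ : x = p * (p * x + q * y) - q * (p * y - q * x)); last first.
    by rewrite -[LHS]mul1r -pq; ring.
  apply: le_trans (ler_normB _ _) _.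
  have : `|p * (p * x + q * y)| <= r / 2 + (18 / 25).
    by rewrite normrM -[leRHS]mul1r; apply: ler_pM.
  have : `|q * (p * y - q * x)| <= (18 / 25) * sr.
    by rewrite normrM -[leRHS]mul1r; apply: ler_pM.
  nra.
- have : `|p| * `|y - q / p * x| <= (18 / 25) * sr.
    rewrite -normrM (_ : p * _ = p * y - q * x)//; by field.
  have := normr_ge0 (y - q / p * x); nra.
- by rewrite opprK addrC; lra.
Qed.

(** * Counting grid points by slicing *)

Lemma card_ord_diam N D (S : {set 'I_N}) :
  (forall i j, i \in S -> j \in S -> (i <= j + D)%N) -> (#|S| <= D.+1)%N.
Proof.
move=> SD; have [->|[i0 Si0]] := set_0Vmem S; first by rewrite cards0.
case: (arg_minnP (fun i : 'I_N => val i) Si0) => a Sa amin.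
rewrite -[D.+1]card_ord -(@card_in_imset _ _ (fun i : 'I_N => inord (i - a) : 'I_D.+1)).
  exact: max_card.
move=> i j Si Sj /(congr1 val); rewrite /= !inordK.
- move=> e; apply/val_inj; have := amin i Si; have := amin j Sj => /=.
  by move: e => /= e h1 h2; rewrite -(subnK h1) -(subnK h2) e.
- by rewrite ltnS leq_subLR SD.
- by rewrite ltnS leq_subLR SD.
Qed.

Lemma sum_indic {R : realType} (T : finType) (P : pred T) :
  \sum_(i : T) (P i)%:R = #|[set i | P i]%SET|%:R :> R.
Proof.
rewrite -natr_sum -sum1dep_card [in RHS]big_mkcond; congr (_%:R).
Qed.

(** An interval of length 2 A holds at most 2 A / s + 1 points of the progression; [s <= A] absorbs
    the endpoint term. *)
Lemma grid_count_le {R : realType} N (s x A : R) : 0 < s -> s <= A ->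
  \sum_(i < N) (`|s * i%:R - x| <= A)%R%:R <= 3 * A / s.
Proof.
move=> s0 sA; rewrite sum_indic.
have A2 : 0 <= 2 * A / s by rewrite divr_ge0//; lra.
apply: (@le_trans _ _ ((Num.truncn (2 * A / s)).+1%:R)); last first.
  have /andP[h _] := truncn_itv A2.
  rewrite -natr1 (_ : 3 * A / s = 2 * A / s + A / s); last by ring.
  by apply: lerD => //; rewrite ler_pdivlMr// mul1r.
rewrite ler_nat; apply: card_ord_diam => i j; rewrite !inE => hi hj.
rewrite leqNgt; apply/negP => ij.
have : (Num.truncn (2 * A / s)).+1%:R <= (i%:R - j%:R : R).
  by rewrite lerBrDl -natrD ler_nat addnS.
have /andP[_ h] := truncn_itv A2; move=> h2.
have := lt_le_trans h h2; rewrite ltr_pdivrMr//.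
by move: hi hj; rewrite !ler_norml; nra.
Qed.

(** The whole interval lies in the range of the grid, so only the endpoint term is lost, and 2 A / s
    - 1 is still at least A / s. *)
Lemma grid_count_ge {R : realType} N (s x A : R) : 0 < s -> s <= A ->
  (forall y, `|y - x| <= A -> 0 <= y < s * N%:R) ->
  A / s <= \sum_(i < N) (`|s * i%:R - x| <= A)%R%:R.
Proof.
move=> s0 sA rng.
have A0 : 0 < A by apply: lt_le_trans sA.
have xA : 0 <= x - A.
  suff /rng/andP[] : `|x - A - x| <= A by [].
  by rewrite addrC addKr normrN gtr0_norm.
set K := Num.truncn (2 * A / s).
have A2 : 0 <= 2 * A / s by rewrite divr_ge0//; lra.
have /andP[K1 K2] := truncn_itv A2; rewrite -/K in K1 K2.
have xs : 0 <= (x - A) / s by rewrite divr_ge0// ltW.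
(* [a] is the first index strictly to the right of the left endpoint; the [K] indices from [a] on
   stay in the interval. *)
set a := (Num.truncn ((x - A) / s)).+1.
have /andP[a1 a2] := truncn_itv xs; rewrite -/a in a2.
rewrite ltr_pdivrMr// in a2; rewrite ler_pdivlMr// in a1.
rewrite ltr_pdivrMr// in K2; rewrite ler_pdivlMr// in K1.
have aE : a%:R = (Num.truncn ((x - A) / s))%:R + 1 :> R by rewrite natr1.
have in_win l : (l < K)%N -> `|s * (a + l)%:R - x| <= A.
  move=> lK; have lK' : l%:R + 1 <= K%:R :> R by rewrite natr1 ler_nat.
  rewrite ler_norml natrD; move: a1 a2 aE lK' K1.
  set b := (Num.truncn _)%:R => a1 a2 aE lK' K1.
  have l0 : 0 <= l%:R :> R by [].
  have := ler_wpM2l (ltW s0) lK'; have := mulr_ge0 (ltW s0) l0.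
  have : s * a%:R = s * b + s by rewrite aE; ring.
  by rewrite mulrDr; lra.
have aKN l : (l < K)%N -> (a + l < N)%N.
  move=> lK; have /andP[_] := rng _ (in_win _ lK).
  by rewrite ltr_pM2l// ltr_nat.
rewrite sum_indic; apply: (@le_trans _ _ K%:R).
  rewrite ler_pdivrMr//; move: K2; rewrite -natr1; nra.
rewrite ler_nat -[K]card_ord.
pose f (l : 'I_K) : 'I_N := Ordinal (aKN _ (ltn_ord l)).
rewrite -(@card_imset _ _ f); last first.
  by move=> i j /(congr1 val) /= /addnI /val_inj.
rewrite -[X in (X <= _)%N]cardsE; apply/subset_leq_card/fintype.subsetP => i.
by rewrite !inE => /imsetP[l _ ->]; rewrite in_win.
Qed.

(** The spacing [s] is that of the cells and the spacing [d] that of the admissible heights, so all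
    candidate positions of the random points are counted. *)
Definition grid_count {R : realType} (n N : nat) (s d : R)
    (S : R -> R -> R -> Prop) : R :=
  \sum_(i < n) \sum_(j < n) \sum_(m < N)
    `[< S (s * i%:R) (s * j%:R) (d * m%:R) >]%R%:R.

Lemma grid_count_swap {R : realType} n N (s d : R) S :
  grid_count n N s d S = grid_count n N s d (fun x y z => S y x z).
Proof. by rewrite /grid_count exchange_big. Qed.

Lemma grid_count_mono {R : realType} n N (s d : R) (S S' : R -> R -> R -> Prop) :
  (forall x y z, S x y z -> S' x y z) ->
  grid_count n N s d S <= grid_count n N s d S'.
Proof.
move=> SS'; do 3 (apply: ler_sum => ? _).
rewrite ler_nat; case: asboolP => // /SS' S1; by case: asboolP.
Qed.

(** Summation goes from the inside out: the bound for a fibre does not depend on its centre, so the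
    moving centres [f x] and [g x y] cost nothing. *)
Lemma grid_count_graph_le {R : realType} n N (s d x0 A B D : R) f g
    (S : R -> R -> R -> Prop) :
  0 < s -> 0 < d -> s <= A -> s <= B -> d <= D ->
  (forall x y z, S x y z ->
     [/\ `|x - x0| <= A, `|y - f x| <= B & `|z - g x y| <= D]) ->
  grid_count n N s d S <= (3 * A / s) * (3 * B / s) * (3 * D / d).
Proof.
move=> s0 d0 sA sB dD SE.
pose S1 (i : nat) : bool := `|s * i%:R - x0| <= A.
pose S2 (i j : nat) : bool := `|s * j%:R - f (s * i%:R)| <= B.
pose S3 (i j m : nat) : bool := `|d * m%:R - g (s * i%:R) (s * j%:R)| <= D.
have ? : 0 <= 3 * B / s by rewrite divr_ge0 ?mulr_ge0//; lra.
have ? : 0 <= 3 * D / d by rewrite divr_ge0 ?mulr_ge0//; lra.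
apply: (@le_trans _ _ (\sum_(i < n) (S1 i)%:R * \sum_(j < n) (S2 i j)%:R *
    \sum_(m < N) (S3 i j m)%:R)).
  apply: ler_sum => i _; rewrite mulr_sumr; apply: ler_sum => j _.
  rewrite !mulr_sumr; apply: ler_sum => m _; case: asboolP => [/SE[h1 h2 h3]|_].
    by rewrite /S1 h1 /S2 h2 /S3 h3 !mulr1.
  by rewrite !mulr_ge0.
apply: (@le_trans _ _ (\sum_(i < n) (S1 i)%:R * ((3 * B / s) * (3 * D / d)))).
  apply: ler_sum => i _; apply: ler_wpM2l => //.
  apply: (@le_trans _ _ (\sum_(j < n) (S2 i j)%:R * (3 * D / d))).
    by apply: ler_sum => j _; apply: ler_wpM2l => //; exact: grid_count_le.
  by rewrite -mulr_suml; apply: ler_wpM2r => //; exact: grid_count_le.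
rewrite -mulr_suml -[leRHS]mulrA; apply: ler_wpM2r; first by rewrite mulr_ge0.
exact: grid_count_le.
Qed.

Lemma grid_count_graph_ge {R : realType} n N (s d x0 A B D : R) f g
    (S : R -> R -> R -> Prop) :
  0 < s -> 0 < d -> s <= A -> s <= B -> d <= D ->
  (forall x y z, `|x - x0| <= A -> `|y - f x| <= B -> `|z - g x y| <= D ->
     S x y z) ->
  (forall x y z, S x y z ->
     [/\ 0 <= x < s * n%:R, 0 <= y < s * n%:R & 0 <= z < d * N%:R]) ->
  (A / s) * (B / s) * (D / d) <= grid_count n N s d S.
Proof.
move=> s0 d0 sA sB dD SE rng.
pose S1 (i : nat) : bool := `|s * i%:R - x0| <= A.
pose S2 (i j : nat) : bool := `|s * j%:R - f (s * i%:R)| <= B.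
pose S3 (i j m : nat) : bool := `|d * m%:R - g (s * i%:R) (s * j%:R)| <= D.
have B0 : 0 <= B by lra.
have D0 : 0 <= D by lra.
have ? : 0 <= B / s by rewrite divr_ge0//; lra.
have ? : 0 <= D / d by rewrite divr_ge0//; lra.
apply: (@le_trans _ _ (\sum_(i < n) (S1 i)%:R * (\sum_(j < n) (S2 i j)%:R *
    \sum_(m < N) (S3 i j m)%:R))); last first.
  apply: ler_sum => i _; rewrite mulr_sumr; apply: ler_sum => j _.
  rewrite mulrA !mulr_sumr; apply: ler_sum => m _; case: asboolP => [_|nS].
    rewrite -!natrM ler_nat.
    by case: (S1 i); case: (S2 i j); case: (S3 i j m).
  rewrite /S1 /S2 /S3; case: (boolP (_ <= A)) => h1; last by rewrite !mul0r.
  case: (boolP (_ <= B)) => h2; last by rewrite mulr0 mul0r.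
  case: (boolP (_ <= D)) => h3; last by rewrite mulr0.
  by case: nS; exact: SE.
apply: (@le_trans _ _ (\sum_(i < n) (S1 i)%:R * ((B / s) * (D / d)))).
  rewrite -mulr_suml -[leLHS]mulrA; apply: ler_wpM2r; first by rewrite mulr_ge0.
  apply: grid_count_ge => // x hx.
  (* The central point of the fibre over [x] belongs to [S], which puts [x] in the range of the
     grid. *)
  have /rng[] // : S x (f x) (g x (f x)) by apply: SE; rewrite // subrr normr0.
apply: ler_sum => i _; rewrite /S1; case: (boolP (_ <= A)) => h1; last by rewrite !mul0r.
rewrite !mul1r.
apply: (@le_trans _ _ (\sum_(j < n) (S2 i j)%:R * (D / d))).
  rewrite -mulr_suml; apply: ler_wpM2r => //.
  apply: grid_count_ge => // y hy.
  have /rng[] // : S (s * i%:R) y (g (s * i%:R) y) by apply: SE; rewrite // subrr normr0.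
apply: ler_sum => j _; rewrite /S2; case: (boolP (_ <= B)) => h2; last by rewrite !mul0r.
rewrite !mul1r; apply: grid_count_ge => // z hz.
have /rng[] // : S (s * i%:R) (s * j%:R) z by apply: SE.
Qed.

(** * Grid points in a plank *)

Lemma slabs0 {R : realType} (p q r sigma : R) : 0 <= r -> 0 <= sigma ->
  slabs p q r sigma 0 0 0.
Proof.
move=> r0 s0; rewrite /slabs !(mulr0, addr0, subr0) normr0.
by split; rewrite ?divr_ge0 ?mulr_ge0 ?sqrtr_ge0.
Qed.

Lemma unit_coord_le1 {R : realType} (p q : R) : p ^+ 2 + q ^+ 2 = 1 ->
  `|p| <= 1 /\ `|q| <= 1.
Proof. by move=> h; rewrite !ler_norml; split; nra. Qed.

Definition plank {R : realType} (p q v0 v1 v2 r sigma : R) : R -> R -> R -> Prop :=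
  fun x y z => slabs p q r sigma (x - v0) (y - v1) (z - v2).

Definition in_cube {R : realType} (r x y z : R) : Prop :=
  [/\ 0 <= x <= r, 0 <= y <= r & 0 <= z <= r].

(** The grid stops before the coordinate [r], so strict upper bounds are needed. A point of the half
    plank may be pushed by [tau] in every coordinate without leaving the full plank, hence the cube;
    [tau] makes 12 tau r equal to the gain 1 - 1/2. *)
Lemma plank_half_interior {R : realType} (p q v0 v1 v2 r : R) :
  p ^+ 2 + q ^+ 2 = 1 -> 1 <= r ->
  (forall x y z, plank p q v0 v1 v2 r 1 x y z -> in_cube r x y z) ->
  forall x y z, plank p q v0 v1 v2 r (1 / 2) x y z ->
  [/\ 0 <= x < r, 0 <= y < r & 0 <= z < r].
Proof.
move=> pq r1 box x y z P.
have [p1 q1] := unit_coord_le1 pq.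
have r0 : 0 <= r by lra.
have /box[vx vy vz] : plank p q v0 v1 v2 r 1 v0 v1 v2.
  by rewrite /plank !subrr; apply: slabs0.
have /box[hx hy hz] : plank p q v0 v1 v2 r 1 x y z.
  by apply: slabs_mono P => //; lra.
pose tau : R := (24 * r)^-1.
have t0 : 0 < tau by rewrite invr_gt0; lra.
have tr : 12 * tau * r <= 1 - 1 / 2.
  by rewrite /tau le_eqVlt; apply/orP; left; apply/eqP; field; lra.
have /box[] : plank p q v0 v1 v2 r 1 (x + tau) (y + tau) (z + tau).
  have ab (a b : R) : `|a - b - (a + tau - b)| <= tau.
    by rewrite (_ : _ - _ = - tau) ?normrN ?gtr0_norm//; ring.
  have aa (a : R) : `|a - a| <= tau by rewrite subrr normr0 ltW.
  apply: (slabs_close r1 p1 q1 (aa p) (aa q) (ab x v0) (ab y v1) (ab z v2) _ _ tr) => //.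
    by rewrite ler_norml; move: vx hx; clear; lra.
  by rewrite ler_norml; move: vy hy; clear; lra.
by move: hx hy hz t0; clear; split; lra.
Qed.

Lemma plank_swap {R : realType} (p q v0 v1 v2 r sigma x y z : R) :
  plank p q v0 v1 v2 r sigma x y z -> plank q p v1 v0 v2 r sigma y x z.
Proof. exact: slabs_swap. Qed.

(** The half plank contains a fibred region whose half-widths are of order [r], sqrt r and 1, as
    long as the horizontal axes are named so that [p] is the larger cosine; otherwise they are
    exchanged. *)
Lemma plank_count_ge {R : realType} (p q v0 v1 v2 r s d : R) n N :
  p ^+ 2 + q ^+ 2 = 1 -> 16 <= Num.sqrt r -> r = s * n%:R -> r = d * N%:R ->
  0 < s -> s <= Num.sqrt r / 8 -> 0 < d -> d <= 1 / 4 ->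
  (forall x y z, plank p q v0 v1 v2 r 1 x y z -> in_cube r x y z) ->
  (r / 64 / s) * (Num.sqrt r / 8 / s) * (1 / 4 / d) <=
  grid_count n N s d (plank p q v0 v1 v2 r (1 / 2)).
Proof.
move=> + r16 rs rd s0 sr d0 dr.
have r0 : 0 <= r by case: (lerP 0 r) => // r0; move: r16; rewrite ltr0_sqrtr//; lra.
have rr : r = Num.sqrt r * Num.sqrt r by rewrite -expr2 sqr_sqrtr.
have r1 : 1 <= r by nra.
have s64 : s <= r / 64 by nra.
have main p' q' w0 w1 : p' ^+ 2 + q' ^+ 2 = 1 -> `|q'| <= `|p'| ->
  (forall x y z, plank p' q' w0 w1 v2 r 1 x y z -> in_cube r x y z) ->
  (r / 64 / s) * (Num.sqrt r / 8 / s) * (1 / 4 / d) <=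
  grid_count n N s d (plank p' q' w0 w1 v2 r (1 / 2)).
  move=> pq qp box.
  apply: (@grid_count_graph_ge _ n N s d w0 _ _ _
    (fun x => w1 + q' / p' * (x - w0))
    (fun x y => v2 - (p' * (x - w0) + q' * (y - w1)))) => //.
    move=> x y z hx hy hz; apply: slabs_half_graph => //.
      by rewrite -addrA -opprD.
    by rewrite opprK; move: hz; rewrite opprB addrA addrAC.
  by move=> x y z; rewrite -rs -rd; apply: plank_half_interior.
move=> pq box; case: (lerP `|q| `|p|) => [qp|/ltW pq']; first exact: main.
rewrite grid_count_swap; apply: (le_trans (main q p v1 v0 _ pq' _)).
- by rewrite addrC.
- by move=> x y z /plank_swap/box[? ? ?]; split.
- by apply: grid_count_mono => x y z /plank_swap.
Qed.

Lemma plank_count_le {R : realType} (p q v0 v1 v2 r s d : R) n N :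
  p ^+ 2 + q ^+ 2 = 1 -> 16 <= Num.sqrt r ->
  0 < s -> s <= Num.sqrt r / 8 -> 0 < d -> d <= 1 / 4 ->
  grid_count n N s d (plank p q v0 v1 v2 r 2) <=
  (3 * r / s) * (3 * (2 * Num.sqrt r) / s) * (3 * 2 / d).
Proof.
move=> + r16 s0 sr d0 dr.
have r0 : 0 <= r by case: (lerP 0 r) => // r0; move: r16; rewrite ltr0_sqrtr//; lra.
have rr : r = Num.sqrt r * Num.sqrt r by rewrite -expr2 sqr_sqrtr.
have s64 : s <= r by nra.
have main p' q' w0 w1 : p' ^+ 2 + q' ^+ 2 = 1 -> `|q'| <= `|p'| ->
  grid_count n N s d (plank p' q' w0 w1 v2 r 2) <=
  (3 * r / s) * (3 * (2 * Num.sqrt r) / s) * (3 * 2 / d).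
  move=> pq qp.
  apply: (@grid_count_graph_le _ n N s d w0 _ _ _
    (fun x => w1 + q' / p' * (x - w0))
    (fun x y => v2 - (p' * (x - w0) + q' * (y - w1)))) => //; [lra|lra|].
  move=> x y z /(slabs_two_graph pq qp r16)[hx hy hz]; split => //.
    by rewrite opprD addrA.
  by rewrite opprD addrA.
move=> pq; case: (lerP `|q| `|p|) => [qp|/ltW pq']; first exact: main.
rewrite grid_count_swap; apply: (le_trans _ (main q p v1 v0 _ pq')).
  by apply: grid_count_mono => x y z /plank_swap.
by rewrite addrC.
Qed.

(** * Exponential moments and a balanced choice *)

(** This is the moment generating function of a sum of independent indicators, multiplied by the
    number of choices: the sum over [f] factors over the cells, and a cell with hitting probability
    x has mean factor 1 + (w - 1) x, at most the exponential of (w - 1) x. *)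
Lemma sum_choice_le {R : realType} (I : finType) M (w : R)
    (S : I -> 'I_M.+1 -> bool) : 0 <= w ->
  \sum_(f : {ffun I -> 'I_M.+1}) \prod_c (if S c (f c) then w else 1) <=
  M.+1%:R ^+ #|I| *
  expR ((w - 1) * (\sum_c \sum_u (S c u)%:R / M.+1%:R)).
Proof.
move=> w0.
rewrite -(bigA_distr_bigA (fun c u => if S c u then w else 1)) /=.
rewrite -prodr_const mulr_sumr expR_sum -big_split /=.
apply: ler_prod => c _; apply/andP; split.
  by apply: sumr_ge0 => u _; case: ifP.
rewrite (_ : \sum_j _ = M.+1%:R * (1 + (w - 1) * (\sum_u (S c u)%:R / M.+1%:R))).
  by apply: ler_wpM2l => //; exact: expR_ge1Dx.
rewrite -mulr_suml; have H : M.+1%:R != 0 :> R by rewrite pnatr_eq0.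
transitivity (M.+1%:R + (w - 1) * \sum_u (S c u)%:R); last first.
  by move: (M.+1%:R) H => k k0; field.
have -> : M.+1%:R = \sum_(u < M.+1) 1 :> R by rewrite sumr_const card_ord.
rewrite mulr_sumr -big_split /=.
by apply: eq_bigr => u _; case: (S c u); rewrite ?mulr1 ?mulr0; ring.
Qed.

(** Chernoff bounds with a union bound. The weights exp(-1) <= 1/2 and exp(1/2) <= 2 give failure
    bounds exp(- a / 4) for falling below a / 4 and exp(- b) for exceeding 4 b. *)
Lemma exists_balanced_choice {R : realType} (I : finType) M (T1 T2 : finType)
    (S1 : T1 -> I -> 'I_M.+1 -> bool) (S2 : T2 -> I -> 'I_M.+1 -> bool)
    (a b : R) :
  (forall t, a <= \sum_c \sum_u (S1 t c u)%:R / M.+1%:R) ->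
  (forall t, \sum_c \sum_u (S2 t c u)%:R / M.+1%:R <= b) ->
  #|T1|%:R * expR (- (a / 4)) + #|T2|%:R * expR (- b) < 1 ->
  exists f : {ffun I -> 'I_M.+1},
    (forall t, a / 4 <= \sum_c (S1 t c (f c))%:R) /\
    (forall t, \sum_c (S2 t c (f c))%:R <= 4 * b).
Proof.
move=> ha hb hsum.
pose Z1 t (f : {ffun I -> 'I_M.+1}) : R := \sum_c (S1 t c (f c))%:R.
pose Z2 t (f : {ffun I -> 'I_M.+1}) : R := \sum_c (S2 t c (f c))%:R.
(* Every violated condition makes its term of [W] exceed 1, so a choice with [W f < 1] satisfies
   them all; it exists because the mean of [W] is below 1. *)
pose W f := \sum_t expR (a / 4 - Z1 t f) + \sum_t expR (2^-1 * Z2 t f - 2 * b).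
have prodE (w : R) (S : I -> 'I_M.+1 -> bool) (f : {ffun I -> 'I_M.+1}) :
    expR (w * \sum_c (S c (f c))%:R) =
    \prod_c (if S c (f c) then expR w else 1).
  rewrite mulr_sumr expR_sum; apply: eq_bigr => c _.
  by case: (S c (f c)); rewrite ?mulr1// mulr0 expR0.
have eN1 : expR (- 1) <= 1 / 2 :> R.
  rewrite expRN div1r lef_pV2 ?posrE ?expR_gt0//.
  by have := @expR_ge1Dx R 1; lra.
have e12 : expR 2^-1 <= 2 :> R.
  rewrite -[2^-1]opprK expRN -[leRHS]invrK lef_pV2 ?posrE ?expR_gt0//.
  by have := @expR_ge1Dx R (- 2^-1); lra.
set m : R := M.+1%:R ^+ #|I|.
have m0 : 0 < m by rewrite exprn_gt0.
have sumW : \sum_f W f < m.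
  rewrite big_split /= exchange_big /= [X in _ + X]exchange_big /=.
  apply: (@le_lt_trans _ _ (m * (#|T1|%:R * expR (- (a / 4)) +
      #|T2|%:R * expR (- b)))); last by rewrite gtr_pMr.
  rewrite mulrDr; apply: lerD.
    rewrite mulrCA -sum1_card natr_sum mulr_suml; apply: ler_sum => t _.
    under eq_bigr do rewrite expRD -mulN1r prodE.
    rewrite -mulr_sumr mul1r.
    apply: (@le_trans _ _ (expR (a / 4) * (m * expR (- (a / 2))))).
      apply: ler_wpM2l; first exact: expR_ge0.
      apply: le_trans (sum_choice_le _ (expR_ge0 _)) _.
      apply: ler_wpM2l; first exact: ltW.
      rewrite ler_expR; have := ha t; set mu := \sum_c _ => amu.
      have mu0 : 0 <= mu.
        by apply: sumr_ge0 => c _; apply: sumr_ge0 => u _; rewrite divr_ge0.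
      by nra.
    by rewrite mulrCA -expRD; apply: ler_wpM2l; [exact: ltW | rewrite ler_expR; lra].
  rewrite mulrCA -sum1_card natr_sum mulr_suml; apply: ler_sum => t _.
  under eq_bigr do rewrite addrC expRD prodE.
  rewrite -mulr_sumr mul1r.
  apply: (@le_trans _ _ (expR (- (2 * b)) * (m * expR b))).
    apply: ler_wpM2l; first exact: expR_ge0.
    apply: le_trans (sum_choice_le _ (expR_ge0 _)) _.
    apply: ler_wpM2l; first exact: ltW.
    rewrite ler_expR; have := hb t; set mu := \sum_c _ => amu.
    have mu0 : 0 <= mu.
      by apply: sumr_ge0 => c _; apply: sumr_ge0 => u _; rewrite divr_ge0.
    by nra.
  by rewrite mulrCA -expRD; apply: ler_wpM2l; [exact: ltW | rewrite ler_expR; lra].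
have [f Wf] : exists f, W f < 1.
  apply: contrapT => /forallNP h.
  have : m <= \sum_f W f.
    rewrite /m -natrX -[X in (X ^ _)%N]card_ord -card_ffun -sum1_card natr_sum.
    by apply: ler_sum => f _; rewrite leNgt; apply/negP/h.
  by rewrite leNgt sumW.
have small (x : R) (T : finType) (F : T -> R) t : (forall t, 0 <= F t) ->
    \sum_t F t < 1 -> F t < 1.
  move=> F0; apply: le_lt_trans; rewrite (bigD1 t)//= lerDl.
  exact: sumr_ge0.
have W1 : 0 <= \sum_t expR (a / 4 - Z1 t f) by apply: sumr_ge0 => *; apply: expR_ge0.
have W2 : 0 <= \sum_t expR (2^-1 * Z2 t f - 2 * b) by apply: sumr_ge0 => *; apply: expR_ge0.
exists f; split => t.
  have : expR (a / 4 - Z1 t f) < 1.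
    apply: (small 0 _ (fun t => expR (a / 4 - Z1 t f))).
      by move=> ?; apply: expR_ge0.
    by move: Wf; rewrite /W; lra.
  by rewrite expR_lt1 /Z1 subr_lt0 => /ltW.
have : expR (2^-1 * Z2 t f - 2 * b) < 1.
  apply: (small 0 _ (fun t => expR (2^-1 * Z2 t f - 2 * b))).
    by move=> ?; apply: expR_ge0.
  by move: Wf; rewrite /W; lra.
by rewrite expR_lt1 /Z2; lra.
Qed.

(** * A finite net of planks *)

(* The sigma-dilate of the plank encoded by w, as a predicate on coordinates. *)
Definition cplank {R : realType} (r sigma : R) (w : 'rV[R]_3 * R) :
    R -> R -> R -> Prop :=
  plank (cos w.2) (sin w.2) (entry w.1 0) (entry w.1 1) (entry w.1 2) r sigma.

Definition cplank_in_cube {R : realType} (r : R) (w : 'rV[R]_3 * R) : Prop :=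
  forall x y z, cplank r 1 w x y z -> in_cube r x y z.

Section Rounding.
Context {R : realType} (tau : R) (L : nat).

(** [inord] sends an index above [L] to 0, so the value is meaningful only for nonnegative x with x
    / tau < L + 1. *)
Definition round1 (x : R) : 'I_L.+1 := inord (Num.truncn (x / tau)).

(** Recording the cosine and the sine instead of the angle avoids the jump at [pi]; adding 1 makes
    them nonnegative. *)
Definition round (w : 'rV[R]_3 * R) :
    'I_L.+1 * 'I_L.+1 * 'I_L.+1 * 'I_L.+1 * 'I_L.+1 :=
  (round1 (cos w.2 + 1), round1 (sin w.2 + 1), round1 (entry w.1 0),
   round1 (entry w.1 1), round1 (entry w.1 2)).

Lemma round1_close r x y : 0 < tau -> r / tau < L.+1%:R ->
  0 <= x <= r -> 0 <= y <= r -> round1 x = round1 y -> `|x - y| <= tau.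
Proof.
move=> t0 rL /andP[x0 xr] /andP[y0 yr] /(congr1 val).
have xt : 0 <= x / tau by rewrite divr_ge0// ltW.
have yt : 0 <= y / tau by rewrite divr_ge0// ltW.
have lt z : 0 <= z / tau -> z <= r -> (Num.truncn (z / tau) < L.+1)%N.
  move=> z0 zr; rewrite truncn_lt_nat//; apply: le_lt_trans rL.
  by rewrite ler_pM2r ?invr_gt0.
rewrite /= !inordK ?lt// => e.
have /andP[] := truncn_itv xt; have /andP[] := truncn_itv yt.
rewrite e -!natr1; rewrite !ltr_pdivrMr// !ler_pdivlMr//.
by rewrite ler_norml; lra.
Qed.

(** Planks with the same code have parameters within [tau], so [slabs_close] applies. With [2 <= r],
    the shifted cosine and sine fit in the same range [0, r] as the centres. *)
Lemma round_close r s1 s2 (w w' : 'rV[R]_3 * R) :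
  0 < tau -> 2 <= r -> r / tau < L.+1%:R ->
  12 * tau * r <= s2 - s1 ->
  cplank_in_cube r w -> cplank_in_cube r w' -> round w = round w' ->
  forall x y z, in_cube r x y z -> cplank r s1 w x y z -> cplank r s2 w' x y z.
Proof.
move=> t0 r2 rL ts cw cw' [ep eq e0 e1 e2] x y z [hx hy hz].
have r0 : 0 <= r by lra.
have center v : cplank_in_cube r v ->
    in_cube r (entry v.1 0) (entry v.1 1) (entry v.1 2).
  by apply; rewrite /cplank /plank !subrr; apply: slabs0.
have [vx vy vz] := center _ cw; have [vx' vy' vz'] := center _ cw'.
have trig (u u' : R) : -1 <= u <= 1 -> -1 <= u' <= 1 ->
    round1 (u + 1) = round1 (u' + 1) -> `|u - u'| <= tau.
  move=> hu hu' /(round1_close t0 rL).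
  by rewrite opprD addrACA subrr addr0; apply; lra.
have trl (a b b' : R) : `|b - b'| <= tau -> `|a - b - (a - b')| <= tau.
  by rewrite (_ : a - b - (a - b') = - (b - b')) ?normrN//; ring.
have abs_sub (a b : R) : 0 <= a <= r -> 0 <= b <= r -> `|a - b| <= r.
  by rewrite ler_norml; lra.
apply: slabs_close (trig _ _ _ _ ep) (trig _ _ _ _ eq)
  (trl _ _ _ (round1_close t0 rL vx vx' e0))
  (trl _ _ _ (round1_close t0 rL vy vy' e1))
  (trl _ _ _ (round1_close t0 rL vz vz' e2))
  (abs_sub _ _ hx vx) (abs_sub _ _ hy vy) ts; rewrite ?cos_geN1 ?cos_le1 ?sin_geN1 ?sin_le1//.
- by lra.
- by rewrite ler_norml cos_geN1 cos_le1.
- by rewrite ler_norml sin_geN1 sin_le1.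
Qed.

End Rounding.

(** * Random heights that suit all planks at once *)

(** Euclidean division by [M.+1] splits a height index into the cell and the position inside it. *)
Lemma sum_cells {R : realType} n M (s d : R) (S : R -> R -> R -> Prop) :
  \sum_(c : 'I_n * 'I_n * 'I_n) \sum_(u < M.+1)
    `[< S (s * c.1.1%:R) (s * c.1.2%:R) (d * (c.2 * M.+1 + u)%:R) >]%R%:R
  = grid_count n (n * M.+1) s d S :> R.
Proof.
rewrite /grid_count [RHS]pair_bigA /=.
rewrite -(pair_bigA _ (fun (ij : 'I_n * 'I_n) (k : 'I_n) => \sum_(u < M.+1)
  `[< S (s * ij.1%:R) (s * ij.2%:R) (d * (k * M.+1 + u)%:R) >]%R%:R)) /=.
apply: eq_bigr => -[i j] _ /=.
pose F (m : nat) : R := `[< S (s * i%:R) (s * j%:R) (d * m%:R) >]%R%:R.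
rewrite -[RHS](big_mkord xpredT F) big_nat_mul big_mkord.
apply: eq_bigr => k _.
have -> : \sum_(k * M.+1 <= m < k.+1 * M.+1) F m =
    \sum_(0 <= u < M.+1) F (u + k * M.+1)%N.
  by rewrite mulSn -{1}[(k * M.+1)%N]add0n big_addn addnK.
rewrite big_mkord.
by apply: eq_bigr => u _; rewrite /F addnC.
Qed.

Definition jittered {R : realType} n M (s d : R)
    (f : {ffun 'I_n * 'I_n * 'I_n -> 'I_M.+1}) (c : 'I_n * 'I_n * 'I_n)
    (S : R -> R -> R -> Prop) : bool :=
  `[< S (s * c.1.1%:R) (s * c.1.2%:R) (d * (c.2 * M.+1 + f c)%:R) >].

(** One representative is kept for each code that occurs. A plank contains the half of its
    representative and lies in the double of it, so the balanced choice is applied to these halves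
    and doubles only, at most (L + 1)^5 of each. *)
Lemma exists_jitter {R : realType} n M L (r s d : R)
    (a := r * Num.sqrt r / (2048 * s ^+ 3))
    (b := 108 * (r * Num.sqrt r) / s ^+ 3) :
  16 <= Num.sqrt r -> r = s * n%:R -> s = d * M.+1%:R ->
  0 < s -> s <= Num.sqrt r / 8 -> 0 < d -> d <= 1 / 4 ->
  24 * r ^+ 2 < L.+1%:R ->
  L.+1%:R ^+ 5 * (expR (- (a / 4)) + expR (- b)) < 1 ->
  exists f : {ffun 'I_n * 'I_n * 'I_n -> 'I_M.+1},
    forall w, cplank_in_cube r w ->
    a / 4 <= \sum_c (jittered s d f c (cplank r 1 w))%:R <= 4 * b.
Proof.
move=> r16 rs sd s0 sr d0 dr Lr small.
have r0 : 0 < r by rewrite -sqrtr_gt0; lra.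
have rr : r = Num.sqrt r * Num.sqrt r by rewrite -expr2 sqr_sqrtr// ltW.
have r2 : 2 <= r by nra.
(* Then 12 tau r = 1/2, enough to pass from scale 1/2 to 1 and from 1 to 2, and r / tau = 24 r^2. *)
pose tau : R := (24 * r)^-1.
have t0 : 0 < tau by rewrite invr_gt0; lra.
have tr : 12 * tau * r = 1 / 2 by rewrite /tau; field; move: r0; clear; lra.
have rL : r / tau < L.+1%:R by rewrite /tau invrK mulrCA -expr2.
pose occ t := `[< exists w, cplank_in_cube r w /\ round tau L w = t >].
pose T := {t | occ t}.
have rep (t : T) : {w | cplank_in_cube r w /\ round tau L w = val t}.
  by apply: cid; case: t => t /= /asboolP.
pose W t := sval (rep t).
have Wc t : cplank_in_cube r (W t) by case: (svalP (rep t)).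
have Wr t : round tau L (W t) = val t by case: (svalP (rep t)).
have rN : r = d * (n * M.+1)%:R by rewrite rs sd natrM; ring.
have M0 : M.+1%:R != 0 :> R by rewrite pnatr_eq0.
pose S1 (t : T) (c : 'I_n * 'I_n * 'I_n) (u : 'I_M.+1) : bool :=
  `[< cplank r (1 / 2) (W t) (s * c.1.1%:R) (s * c.1.2%:R)
      (d * (c.2 * M.+1 + u)%:R) >].
pose S2 (t : T) (c : 'I_n * 'I_n * 'I_n) (u : 'I_M.+1) : bool :=
  `[< cplank r 2 (W t) (s * c.1.1%:R) (s * c.1.2%:R)
      (d * (c.2 * M.+1 + u)%:R) >].
have sdM : s ^+ 3 = s * s * (d * M.+1%:R) by rewrite -sd; ring.
have mean (S : R -> R -> R -> Prop) :
    \sum_(c : 'I_n * 'I_n * 'I_n) \sum_(u < M.+1)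
    (`[< S (s * c.1.1%:R) (s * c.1.2%:R) (d * (c.2 * M.+1 + u)%:R) >]%R%:R
      / M.+1%:R) = grid_count n (n * M.+1) s d S / M.+1%:R :> R.
  rewrite -sum_cells mulr_suml; apply: eq_bigr => c _.
  by rewrite mulr_suml.
have h1 t : a <= \sum_c \sum_u (S1 t c u)%:R / M.+1%:R.
  rewrite mean ler_pdivlMr ?ltr0n//.
  apply: le_trans (plank_count_ge (cos2Dsin2 _) r16 rs rN s0 sr d0 dr (Wc t)).
  rewrite /a sdM le_eqVlt; apply/orP; left; apply/eqP.
  by move: (M.+1%:R : R) M0 => m m0; field; rewrite m0 !gt_eqF.
have h2 t : \sum_c \sum_u (S2 t c u)%:R / M.+1%:R <= b.
  rewrite mean ler_pdivrMr ?ltr0n//.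
  apply: le_trans (plank_count_le _ _ _ _ _ (cos2Dsin2 _) r16 s0 sr d0 dr) _.
  rewrite /b sdM le_eqVlt; apply/orP; left; apply/eqP.
  by move: (M.+1%:R : R) M0 => m m0; field; rewrite m0 !gt_eqF.
have Tle : #|{: T}|%:R <= L.+1%:R ^+ 5 :> R.
  rewrite -natrX ler_nat card_sig; apply: leq_trans (max_card _) _.
  by rewrite !card_prod !card_ord !expnS expn0 muln1 !mulnA.
have [] := exists_balanced_choice h1 h2.
  apply: le_lt_trans small; rewrite -mulrDr.
  by apply: ler_wpM2r => //; rewrite addr_ge0// expR_ge0.
move=> f [f1 f2]; exists f => w wc.
have ow : occ (round tau L w) by apply/asboolP; exists w.
pose t : T := exist _ (round tau L w) ow.
have wW : round tau L w = round tau L (W t) by rewrite Wr.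
apply/andP; split.
  apply: le_trans (f1 t) _; apply: ler_sum => c _; rewrite ler_nat.
  rewrite /S1 /jittered; case: asboolP => // h; case: asboolP => // -[].
  apply: (round_close t0 r2 rL _ (Wc t) wc _ _ h); rewrite ?tr//; first lra.
  by apply: (Wc t); apply: slabs_mono h => //; lra.
apply: le_trans _ (f2 t); apply: ler_sum => c _; rewrite ler_nat.
rewrite /S2 /jittered; case: asboolP => // h; case: asboolP => // -[].
apply: (round_close t0 r2 rL _ wc (Wc t) _ _ h); rewrite ?tr//; first lra.
exact: wc.
Qed.

(** * Incomparable collections of lightplanks *)

Definition at_point {R : realType} (S : R -> R -> R -> Prop) (x : 'rV[R]_3) : Prop :=
  S (entry x 0) (entry x 1) (entry x 2).

Lemma lightplank_cplank {R : realType} (r : R) w (x : 'rV[R]_3) : 0 < r ->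
  lightplank 1 r w x <-> at_point (cplank r 1 w) x.
Proof. by case: w => v t r0; exact: lightplankP. Qed.

Lemma dilate_lightplank {R : realType} (K r : R) w (x : 'rV[R]_3) :
  0 < r -> 0 < K ->
  dilate K w.1 (lightplank 1 r w) x <-> at_point (cplank r K w) x.
Proof.
move=> r0 K0; rewrite /at_point /cplank /plank.
rewrite -[X in slabs _ _ _ X]mulr1.
have Kn : K != 0 by rewrite gt_eqF.
split.
  case=> y /(lightplank_cplank _ _ r0) hy <-.
  rewrite !entryD !entryZ !entryB -!addrA !(addrCA _ (K * _)).
  rewrite !subrr !addr0; exact: (proj1 (slabsZ _ _ _ _ _ _ _ K0) hy).
move=> h; exists (w.1 + K^-1 *: (x - w.1)).
  apply/(lightplank_cplank _ _ r0); rewrite /at_point /cplank /plank.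
  rewrite !entryD !entryZ !entryB -!addrA !(addrCA _ (K^-1 * _)) !subrr !addr0.
  by apply: (proj2 (slabsZ _ _ _ _ _ _ _ K0)); rewrite !mulVKf.
by rewrite addrAC subrr add0r scalerA divff// scale1r addrC subrK.
Qed.

Lemma at_point_vec3 {R : realType} (S : R -> R -> R -> Prop) x y z :
  at_point S (vec3 x y z) = S x y z.
Proof. by rewrite /at_point; have [-> -> ->] := vec3E x y z. Qed.

Lemma box_in_cube {R : realType} (r : R) x : box r x <-> at_point (in_cube r) x.
Proof.
split; first by move=> h; split; apply: h.
case=> h0 h1 h2 [[|[|[|//]]] hi].
- by move: h0; rewrite /entry (_ : inord 0 = Ordinal hi)//; apply/val_inj; rewrite /= inordK.
- by move: h1; rewrite /entry (_ : inord 1 = Ordinal hi)//; apply/val_inj; rewrite /= inordK.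
- by move: h2; rewrite /entry (_ : inord 2 = Ordinal hi)//; apply/val_inj; rewrite /= inordK.
Qed.

Lemma lightplank_sub_box {R : realType} (r : R) w : 0 < r ->
  lightplank 1 r w `<=` box r <-> cplank_in_cube r w.
Proof.
move=> r0; split => [sub x y z h|sub x /(lightplank_cplank _ _ r0) h].
  rewrite -at_point_vec3; apply/box_in_cube/sub/lightplank_cplank => //.
  by rewrite at_point_vec3.
by apply/box_in_cube; apply: sub.
Qed.

Lemma lightplank_sub_dilate {R : realType} (K r : R) w w' : 0 < r -> 0 < K ->
  lightplank 1 r w `<=` dilate K w'.1 (lightplank 1 r w') <->
  (forall x y z, cplank r 1 w x y z -> cplank r K w' x y z).
Proof.
move=> r0 K0; split => [sub x y z h|sub x /(lightplank_cplank _ _ r0) h].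
  rewrite -at_point_vec3; apply/(dilate_lightplank _ _ r0 K0)/sub.
  by apply/lightplank_cplank => //; rewrite at_point_vec3.
by apply/dilate_lightplank => //; apply: sub.
Qed.

(** With 12 tau r = K - 1, two planks with the same code lie in the [K]-dilates of each other;
    rounding is therefore injective on the collection, with values in a finite set. *)
Lemma incomparable_finite {R : realType} (K r : R) PP : 1 < K -> 2 <= r ->
  pairwise_incomparable K r PP -> finite_set PP.
Proof.
move=> K1 r2 [inbox inc].
have r0 : 0 < r by lra.
pose tau : R := (K - 1) / (12 * r).
have t0 : 0 < tau by rewrite divr_gt0//; lra.
have tr : 12 * tau * r = K - 1 by rewrite /tau; field; move: r0; clear; lra.
pose L := Num.truncn (r / tau).
have rL : r / tau < L.+1%:R.
  have rt : 0 <= r / tau by rewrite divr_ge0// ltW.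
  by have /andP[] := truncn_itv rt.
have inj : {in PP &, injective (round tau L)}.
  move=> w w'; rewrite !inE => Pw Pw' e; apply: contrapT => ww'.
  have [nsub _] := inc _ _ Pw Pw' ww'; apply: nsub.
  apply/lightplank_sub_dilate; [lra|lra|move=> x y z h].
  have [_ /(lightplank_sub_box _ r0) cw] := inbox _ Pw.
  have [_ /(lightplank_sub_box _ r0) cw'] := inbox _ Pw'.
  apply: (round_close t0 r2 rL _ cw cw' e _ h); first by rewrite tr.
  exact: cw.
by rewrite -(eq_finite_set (inj_card_eq inj)); exact: finite_finset.
Qed.

(** A plank incomparable to every member could be adjoined, so by maximality it would already be a
    member; but no plank is incomparable to itself. *)
Lemma maximal_comparable {R : realType} (K r : R) PP w : 1 < K -> 0 < r ->
  maximal_incomparable K r PP -> lightplanks_in_box r w ->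
  exists2 w', PP w' & ~ incomparable K 1 r w' w.
Proof.
move=> K1 r0 [[inbox inc] max] wbox.
have refl : ~ incomparable K 1 r w w.
  case=> nsub _; apply: nsub; apply/lightplank_sub_dilate => //; first lra.
  by move=> x y z h; apply: slabs_mono h => //; lra.
apply: contrapT => no.
have no' w' : PP w' -> incomparable K 1 r w' w.
  by move=> Pw'; apply: contrapT => ?; apply: no; exists w'.
have PPw : PP w; last by case: refl; exact: no'.
rewrite -(max (PP `|` [set w])).
- by right.
- split; first by move=> x [/inbox//|->].
  move=> p q [Pp|->] [Pq|->] // pq.
  + exact: inc.
  + exact: no'.
  + by have [] := no' _ Pq.
- by move=> x; left.
Qed.

(** * Geometry of comparable planks *)

(* Compare the two endpoints of the long axis of the smaller plank. *)
Lemma plank_sub_direction {R : realType}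
    (p q v0 v1 v2 p' q' v0' v1' v2' r K : R) :
  p ^+ 2 + q ^+ 2 = 1 -> 0 < r -> 0 <= K ->
  (forall x y z, plank p q v0 v1 v2 r 1 x y z ->
     plank p' q' v0' v1' v2' r K x y z) ->
  1 - (p * p' + q * q') <= 3 * K / r.
Proof.
move=> pq r0 K0 sub.
have /andP[u1 u2] := @inv_sqrt2_bounds R.
have tip e : `|e| = 1 -> plank p q v0 v1 v2 r 1
    (v0 - e * r / 4 * p) (v1 - e * r / 4 * q) (v2 + e * r / 4).
  move=> e1; rewrite /plank /slabs.
  have -> : p * (v0 - e * r / 4 * p - v0) + q * (v1 - e * r / 4 * q - v1) =
      - (e * r / 4) * (p ^+ 2 + q ^+ 2) by ring.
  rewrite pq; split.
  - rewrite (_ : _ + _ = 0) ?normr0; last by ring.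
    by apply: divr_ge0; rewrite ?sqrtr_ge0.
  - rewrite (_ : _ - _ = 0) ?normr0; last by ring.
    by rewrite divr_ge0// mulr_ge0// sqrtr_ge0.
  - rewrite (_ : _ - _ = e * (r / 2)); last by field.
    by rewrite normrM e1 gtr0_norm ?divr_gt0//; lra.
have [h1 _ _] := sub _ _ _ (tip 1 (normr1 _)).
have [h2 _ _] := sub _ _ _ (tip (-1) (normrN1 _)).
rewrite ler_pdivlMr//.
have K1 : K / Num.sqrt 2 <= K * (18 / 25) by apply: ler_wpM2l.
by move: h1 h2 K0 K1; clear; rewrite !ler_norml; lra.
Qed.

(* Comparability gives bounds in the frame of one of the two planks only; they
   survive, up to powers of K, in any frame at distance O((K / r)^(1/2)). *)
Lemma slabs_rotate {R : realType} (p q p' q' r K x y z : R) :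
  p ^+ 2 + q ^+ 2 = 1 -> p' ^+ 2 + q' ^+ 2 = 1 -> 1 <= K ->
  16 <= Num.sqrt r -> 1 - (p * p' + q * q') <= 3 * K / r ->
  slabs p' q' r K x y z ->
  `|p * x + q * y + z| <= 3 * K ^+ 2 /\
  `|p * y - q * x| <= 2 * K ^+ 2 * Num.sqrt r.
Proof.
move=> pq pq' K1 r16 cK [h1 h2 h3].
have r0 : 0 < r by rewrite -sqrtr_gt0; lra.
have rr : r = Num.sqrt r ^+ 2 by rewrite sqr_sqrtr// ltW.
have /andP[u1 u2] := @inv_sqrt2_bounds R.
set u := (Num.sqrt 2)^-1 in u1 u2 h1 h2.
set t := Num.sqrt r in r16 rr h2 *.
set c := p * p' + q * q' in cK.
(* [c] and [sg] are the cosine and the sine of the angle between the frames; [al] and [be] below are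
   the horizontal coordinates in the primed frame. *)
pose sg := q * p' - p * q'.
have cs : c ^+ 2 + sg ^+ 2 = 1.
  transitivity ((p ^+ 2 + q ^+ 2) * (p' ^+ 2 + q' ^+ 2)); first by rewrite /c /sg; ring.
  by rewrite pq pq' mulr1.
pose al := p' * x + q' * y; pose be := p' * y - q' * x.
rewrite -/al -/be in h1 h2 h3.
have xE : x = p' * al - q' * be.
  by rewrite -[LHS]mul1r -pq' /al /be; ring.
have yE : y = q' * al + p' * be.
  by rewrite -[LHS]mul1r -pq' /al /be; ring.
have E1 : p * x + q * y + z = (al + z) - (1 - c) * al + sg * be.
  by rewrite {1}xE {1}yE /c /sg; ring.
have E2 : p * y - q * x = c * be - sg * al.
  by rewrite {1}xE {1}yE /c /sg; ring.
have c1 : 0 <= 1 - c by nra.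
have cN1 : 0 <= 1 + c by nra.
have ct : (1 - c) * t ^+ 2 <= 3 * K.
  by move: cK; rewrite ler_pdivlMr// -rr.
have A1 : `|al + z| <= 18 / 25 * K.
  by apply: le_trans h1 _; rewrite mulrC; apply: ler_wpM2r; lra.
have A2 : `|be| <= 2 / 5 * K * t.
  apply: le_trans h2 _; rewrite invfM -/u.
  have : (K * t) * u <= (K * t) * (18 / 25) by apply: ler_wpM2l => //; nra.
  have : 0 <= K * t by nra.
  by lra.
have K0 : 0 <= K by lra.
have A3 : `|al| <= K * t ^+ 2 / 3.
  have : 0 <= K * (t ^+ 2 - 25) by apply: mulr_ge0 => //; move: r16; clear; nra.
  by move: A1 h3 K1; rewrite -rr; clear; rewrite !ler_norml; lra.
(* Here sg^2 = (1 - c)(1 + c) is at most 2 (1 - c), so the angle is O((K / r)^(1/2)). *)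
have sg2 : (sg * t) ^+ 2 <= 6 * K by rewrite exprMn; nra.
have sK : `|sg * t| <= 5 / 2 * K.
  have : `|sg * t| ^+ 2 <= 6 * K by rewrite real_normK ?num_real.
  by have := normr_ge0 (sg * t); nra.
have t0 : 0 < t by lra.
(* Multiplying by [t] brings in [sg * t], which is bounded in terms of [K] alone. *)
have B1 : `|sg * be| <= K ^+ 2.
  rewrite -(@ler_pM2r _ t)// -[t in leLHS]gtr0_norm// -normrM mulrAC normrM.
  apply: (@le_trans _ _ ((5 / 2 * K) * (2 / 5 * K * t))); last by lra.
  exact: ler_pM.
have B2 : `|sg * al| <= K ^+ 2 * t.
  rewrite -(@ler_pM2r _ t)// -[t in leLHS]gtr0_norm// -normrM mulrAC normrM.
  apply: (@le_trans _ _ ((5 / 2 * K) * (K * t ^+ 2 / 3))); first exact: ler_pM.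
  have : 0 <= K ^+ 2 * t ^+ 2 by rewrite mulr_ge0// sqr_ge0.
  by lra.
have B3 : `|(1 - c) * al| <= K ^+ 2.
  rewrite normrM ger0_norm//.
  apply: (@le_trans _ _ ((1 - c) * (K * t ^+ 2 / 3))); first exact: ler_wpM2l.
  have : K * ((1 - c) * t ^+ 2) <= K * (3 * K) by apply: ler_wpM2l.
  by lra.
have B4 : `|c * be| <= K ^+ 2 * t.
  rewrite normrM; apply: (@le_trans _ _ (1 * (2 / 5 * K * t))).
    by apply: ler_pM => //; rewrite ler_norml; lra.
  rewrite mul1r; apply: ler_wpM2r; nra.
have KK : K <= K ^+ 2 by nra.
rewrite E1 E2; split.
  apply: le_trans (ler_normD _ _) _; apply: le_trans (lerD (ler_normB _ _) (lexx _)) _.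
  by lra.
by apply: le_trans (ler_normB _ _) _; lra.
Qed.

(** All bounds are in the frame of [w], so that two planks comparable to the same [w'] can be
    compared. If [w] is the contained plank, the bounds come in the frame of [w'] and are rotated;
    in the other case the rotation is trivial. *)
Lemma comparable_close {R : realType} (K r : R) w w' :
  1 <= K -> 16 <= Num.sqrt r -> ~ incomparable K 1 r w' w ->
  [/\ 1 - (cos w.2 * cos w'.2 + sin w.2 * sin w'.2) <= 3 * K / r,
    `|cos w.2 * (entry w.1 0 - entry w'.1 0)
      + sin w.2 * (entry w.1 1 - entry w'.1 1)
      + (entry w.1 2 - entry w'.1 2)| <= 3 * K ^+ 2 &
    `|cos w.2 * (entry w.1 1 - entry w'.1 1)
      - sin w.2 * (entry w.1 0 - entry w'.1 0)| <= 2 * K ^+ 2 * Num.sqrt r].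
Proof.
move=> K1 r16 comp.
have r0 : 0 < r by rewrite -sqrtr_gt0; lra.
have K0 : 0 < K by lra.
have center v : cplank r 1 v (entry v.1 0) (entry v.1 1) (entry v.1 2).
  by rewrite /cplank /plank !subrr; apply: slabs0 => //; exact: ltW.
case: (pselect (lightplank 1 r w `<=` dilate K w'.1 (lightplank 1 r w'))).
  move=> /(lightplank_sub_dilate _ _ r0 K0) sub.
  have dir := plank_sub_direction (cos2Dsin2 _) r0 (ltW K0) sub.
  have [h1 h2] := slabs_rotate (cos2Dsin2 _) (cos2Dsin2 _) K1 r16 dir
    (sub _ _ _ (center w)).
  by split.
move=> nsub; case: (pselect (lightplank 1 r w' `<=` dilate K w.1 (lightplank 1 r w))); last first.
  by move=> nsub'; case: comp.
move=> /(lightplank_sub_dilate _ _ r0 K0) sub.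
have dir := plank_sub_direction (cos2Dsin2 _) r0 (ltW K0) sub.
have dir0 : 1 - (cos w.2 * cos w.2 + sin w.2 * sin w.2) <= 3 * K / r.
  by rewrite -!expr2 cos2Dsin2 subrr divr_ge0 ?mulr_ge0// ltW.
have [h1 h2] := slabs_rotate (cos2Dsin2 _) (cos2Dsin2 _) K1 r16 dir0
  (sub _ _ _ (center w')).
split.
- by rewrite [cos w.2 * _]mulrC [sin w.2 * _]mulrC.
- rewrite -normrN; move: h1; congr (`|_| <= _); ring.
- rewrite -normrN; move: h2; congr (`|_| <= _); ring.
Qed.

Lemma nat_spacing {R : realType} (a : R) (m1 m2 : nat) :
  0 < a -> `|a * m1%:R - a * m2%:R| < a -> m1 = m2.
Proof.
move=> a0; rewrite -mulrBr normrM gtr0_norm// gtr_pMr//.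
rewrite ltr_norml => /andP[l1 l2]; case: (ltngtP m1 m2) => // h; exfalso.
  have : m1%:R + 1 <= m2%:R :> R by rewrite natr1 ler_nat.
  by lra.
have : m2%:R + 1 <= m1%:R :> R by rewrite natr1 ler_nat.
by lra.
Qed.

(** * A separated family of about [r ^+ 2] planks *)

Definition ref_dim {R : realType} (x y : R) : nat := (Num.truncn (x / y)).+1.

(** The directions are equally spaced in the sine, which is what comparability controls; the index
    range keeps the sine in [0, 1/2]. *)
Definition ref_sin {R : realType} (K r : R) (m : nat) : R :=
  6 * K * m%:R / Num.sqrt r.

(** The divisors limit the two offsets [a] and [b] of the centre to r / 16 each, and the product of
    the three ranges is at least r^2 / (12 * 64 * 80 * K^5). *)
Definition ref_index {R : realType} (K r : R) : finType :=
  ('I_(ref_dim (Num.sqrt r) (12 * K)) * 'I_(ref_dim r (64 * K ^+ 2)) *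
   'I_(ref_dim (Num.sqrt r) (80 * K ^+ 2)))%type.

(* The center is moved along the two shorter axes only: in the direction of its
   long axis a plank of length r has no room in the cube. *)
Definition ref_plank {R : realType} (K r : R) (c : ref_index K r) :
    'rV[R]_3 * R :=
  let t := asin (ref_sin K r c.1.1) in
  let a := 4 * K ^+ 2 * c.1.2%:R in
  let b := 5 * K ^+ 2 * Num.sqrt r * c.2%:R in
  (vec3 (r / 2 + a * cos t - b * sin t) (r / 2 + a * sin t + b * cos t)
     (r / 2 + a), t).

Lemma ref_dim_le {R : realType} (x y : R) m : 0 < y -> 0 <= x ->
  (m < ref_dim x y)%N -> y * m%:R <= x.
Proof.
move=> y0 x0; rewrite ltnS => h.
have xy : 0 <= x / y by rewrite divr_ge0// ltW.
have /andP[h1 _] := truncn_itv xy.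
rewrite mulrC -ler_pdivlMr//; apply: le_trans h1.
by rewrite ler_nat.
Qed.

Lemma ref_sin_itv {R : realType} (K r : R)
    (m : 'I_(ref_dim (Num.sqrt r) (12 * K))) :
  1 <= K -> 16 <= Num.sqrt r -> 0 <= ref_sin K r m <= 1 / 2.
Proof.
move=> K1 r16.
have t0 : 0 < Num.sqrt r by lra.
have KK : 0 < 12 * K by lra.
have h := ref_dim_le KK (ltW t0) (ltn_ord m).
rewrite /ref_sin; apply/andP; split.
  by rewrite divr_ge0 ?(ltW t0)// mulr_ge0//; lra.
by rewrite ler_pdivrMr//; lra.
Qed.

Lemma sin_ref_plank {R : realType} (K r : R) (c : ref_index K r) :
  1 <= K -> 16 <= Num.sqrt r -> sin (ref_plank c).2 = ref_sin K r c.1.1.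
Proof.
move=> K1 r16.
rewrite asinK// in_itv /=.
by have := ref_sin_itv c.1.1 K1 r16; lra.
Qed.

(** In each coordinate the plank extends at most r / 4 + r / 40 + 18/25 from its centre, and the
    centre is within r / 8 of the centre of the cube; together this is below r / 2 once r >= 256. *)
Lemma ref_plank_in_box {R : realType} (K r : R) (c : ref_index K r) :
  1 <= K -> 16 <= Num.sqrt r -> lightplanks_in_box r (ref_plank c).
Proof.
move=> K1 r16; have r0 : 0 < r by rewrite -sqrtr_gt0; lra.
have tt : -1 <= ref_sin K r c.1.1 <= 1 by have := ref_sin_itv c.1.1 K1 r16; lra.
split.
  have := asin_geNpi2 tt; have := asin_lepi2 tt; have := @pi_gt0 R.
  by rewrite /ref_plank /=; lra.
apply/lightplank_sub_box => // x y z.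
rewrite /cplank /plank /ref_plank /=.
have [-> -> ->] := vec3E
  (r / 2 + 4 * K ^+ 2 * c.1.2%:R * cos (asin (ref_sin K r c.1.1)) -
   5 * K ^+ 2 * Num.sqrt r * c.2%:R * sin (asin (ref_sin K r c.1.1)))
  (r / 2 + 4 * K ^+ 2 * c.1.2%:R * sin (asin (ref_sin K r c.1.1)) +
   5 * K ^+ 2 * Num.sqrt r * c.2%:R * cos (asin (ref_sin K r c.1.1)))
  (r / 2 + 4 * K ^+ 2 * c.1.2%:R).
have pq := cos2Dsin2 (asin (ref_sin K r c.1.1)).
move: (cos _) (sin _) pq => p q pq.
have [p1 q1] := unit_coord_le1 pq.
have t0 : 0 < Num.sqrt r by lra.
have rr : r = Num.sqrt r * Num.sqrt r by rewrite -expr2 sqr_sqrtr// ltW.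
have a16 : 0 <= 4 * K ^+ 2 * c.1.2%:R <= r / 16.
  have KK : 0 < 64 * K ^+ 2 by rewrite mulr_gt0// exprn_gt0//; lra.
  have := ref_dim_le KK (ltW r0) (ltn_ord c.1.2).
  by rewrite mulr_ge0//; lra.
have b16 : 0 <= 5 * K ^+ 2 * Num.sqrt r * c.2%:R <= r / 16.
  have KK : 0 < 80 * K ^+ 2 by rewrite mulr_gt0// exprn_gt0//; lra.
  have := ref_dim_le KK (ltW t0) (ltn_ord c.2) => h.
  apply/andP; split; first by do !apply: mulr_ge0; rewrite ?sqrtr_ge0//; lra.
  by have := ler_wpM2r (ltW t0) h; rewrite -rr; lra.
move: (4 * K ^+ 2 * c.1.2%:R) (5 * K ^+ 2 * Num.sqrt r * c.2%:R) a16 b16.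
move=> a b a16 b16 [h1 h2 h3].
set d0 := x - _ in h1 h2 h3; set d1 := y - _ in h1 h2 h3.
set d2 := z - _ in h1 h2 h3.
have /andP[u1 u2] := @inv_sqrt2_bounds R.
have A : `|p * d0 + q * d1 + d2| <= 18 / 25 by lra.
have B : `|p * d1 - q * d0| <= r / 40.
  apply: le_trans h2 _; rewrite invfM.
  by rewrite [in leRHS]rr; nra.
have C : `|p * d0 + q * d1| <= r / 4 + 18 / 25.
  by move: A h3 r0; clear; rewrite !ler_norml; lra.
have D0 : `|d0| <= r / 4 + 18 / 25 + r / 40.
  rewrite (_ : d0 = p * (p * d0 + q * d1) - q * (p * d1 - q * d0)); last first.
    by rewrite -[LHS]mul1r -pq; ring.
  apply: le_trans (ler_normB _ _) _; rewrite !normrM.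
  by apply: lerD; rewrite -[leRHS]mul1r; apply: ler_pM.
have D1 : `|d1| <= r / 4 + 18 / 25 + r / 40.
  rewrite (_ : d1 = q * (p * d0 + q * d1) + p * (p * d1 - q * d0)); last first.
    by rewrite -[LHS]mul1r -pq; ring.
  apply: le_trans (ler_normD _ _) _; rewrite !normrM.
  by apply: lerD; rewrite -[leRHS]mul1r; apply: ler_pM.
have D2 : `|d2| <= r / 4 + 18 / 25.
  by move: A h3 r0; clear; rewrite !ler_norml; lra.
have shift (e f : R) : `|e| <= 1 -> `|f| <= 1 -> `|a * e + b * f| <= r / 8.
  move=> e1 f1; apply: le_trans (ler_normD _ _) _; rewrite !normrM.
  rewrite (_ : r / 8 = r / 16 * 1 + r / 16 * 1); last by field.
  by apply: lerD; apply: ler_pM => //; rewrite ger0_norm; move: a16 b16; clear; lra.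
have r256 : 256 <= r by rewrite rr; move: r16; clear; nra.
have S0 := shift _ (- q) p1 (_ : `|- q| <= 1).
rewrite normrN in S0; have {}S0 := S0 q1.
have S1 := shift _ _ q1 p1.
have xE : x = d0 + (r / 2 + (a * p + b * - q)) by rewrite /d0; ring.
have yE : y = d1 + (r / 2 + (a * q + b * p)) by rewrite /d1; ring.
have zE : z = d2 + (r / 2 + a) by rewrite /d2; ring.
clear h1 h2 h3 A B C; clearbody d0 d1 d2; rewrite /in_cube xE yE zE.
move: D0 D1 D2 S0 S1 a16 r256; clear; rewrite !ler_norml => D0 D1 D2 S0 S1 a16 r256.
by split; lra.
Qed.

(** Triangle inequality through [w']: each spacing exceeds twice the tolerance, with 6 K against 5 K
    for the direction, 8 K^2 against 6 K^2 for the short form (which sees 2 a), and 5 K^2 sqrt r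
    against 4 K^2 sqrt r for the middle one. *)
Lemma ref_planks_separated {R : realType} (K r : R) (c1 c2 : ref_index K r) w' :
  1 <= K -> 16 <= Num.sqrt r -> ~ incomparable K 1 r w' (ref_plank c1) ->
  ~ incomparable K 1 r w' (ref_plank c2) -> c1 = c2.
Proof.
move=> K1 r16 comp1 comp2.
have [d1 f1 g1] := comparable_close K1 r16 comp1.
have [d2 f2 g2] := comparable_close K1 r16 comp2.
have r0 : 0 < r by rewrite -sqrtr_gt0; lra.
have t0 : 0 < Num.sqrt r by lra.
have tn : Num.sqrt r != 0 by rewrite gt_eqF.
have rr : r = Num.sqrt r ^+ 2 by rewrite sqr_sqrtr// ltW.
have near (c : ref_index K r) :
    1 - (cos (ref_plank c).2 * cos w'.2 + sin (ref_plank c).2 * sin w'.2)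
    <= 3 * K / r -> `|6 * K * c.1.1%:R - sin w'.2 * Num.sqrt r| <= 5 / 2 * K.
  rewrite (sin_ref_plank c K1 r16) ler_pdivlMr// => h.
  have pq := cos2Dsin2 w'.2; have pq' := cos2Dsin2 (ref_plank c).2.
  rewrite (sin_ref_plank c K1 r16) in pq'.
  move: (cos (ref_plank c).2) (cos w'.2) (sin w'.2) h pq pq' => p p' q' h pq pq'.
  rewrite (_ : 6 * K * c.1.1%:R = ref_sin K r c.1.1 * Num.sqrt r); last first.
    by rewrite /ref_sin; field.
  move: (ref_sin K r c.1.1) h pq pq' => q h pq pq'.
  rewrite -mulrBl.
  have : `|(q - q') * Num.sqrt r| ^+ 2 <= 6 * K.
    rewrite real_normK ?num_real// exprMn -rr.
    (* The squared chord between the two unit vectors is twice 1 minus their inner product. *)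
    have : (q - q') ^+ 2 <= 2 * (1 - (p * p' + q * q')).
      by have := sqr_ge0 (p - p'); lra.
    by move=> /(ler_wpM2r (ltW r0)); lra.
  have := normr_ge0 ((q - q') * Num.sqrt r); move: K1; clear; nra.
have e1 : c1.1.1 = c2.1.1.
  apply/val_inj/(@nat_spacing _ (6 * K)); first lra.
  have := near _ d1; have := near _ d2; move: K1; clear.
  by rewrite ler_norml ltr_norml; rewrite ler_norml; lra.
have K20 : 1 <= K ^+ 2 by move: K1; clear; nra.
have pq := cos2Dsin2 (asin (ref_sin K r c1.1.1)).
(* Once the directions agree, both centres are measured in one common frame. *)
move: f1 g1 f2 g2; rewrite /ref_plank /= -e1.
have ent (a b p q : R) := vec3E (r / 2 + a * p - b * q) (r / 2 + a * q + b * p) (r / 2 + a).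
move: (cos _) (sin _) pq => p q pq.
set v1 := vec3 _ _ _; set v2 := vec3 _ _ _.
have [-> -> ->] : [/\ entry v1 0 = _, entry v1 1 = _ & entry v1 2 = _] := ent _ _ _ _.
have [-> -> ->] : [/\ entry v2 0 = _, entry v2 1 = _ & entry v2 2 = _] := ent _ _ _ _.
clear v1 v2; move: (entry w'.1 0) (entry w'.1 1) (entry w'.1 2) => x y z.
have E1 (a b : R) : p * (r / 2 + a * p - b * q - x) + q * (r / 2 + a * q + b * p - y)
    + (r / 2 + a - z) = 2 * a + (p * (r / 2 - x) + q * (r / 2 - y) + (r / 2 - z)).
  transitivity (a * (p ^+ 2 + q ^+ 2) + a + (p * (r / 2 - x) + q * (r / 2 - y) + (r / 2 - z))).
    by ring.
  by rewrite pq; ring.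
have E2 (a b : R) : p * (r / 2 + a * q + b * p - y) - q * (r / 2 + a * p - b * q - x)
    = b + (p * (r / 2 - y) - q * (r / 2 - x)).
  transitivity (b * (p ^+ 2 + q ^+ 2) + (p * (r / 2 - y) - q * (r / 2 - x))).
    by ring.
  by rewrite pq mulr1.
rewrite !E1 !E2.
move: (p * (r / 2 - x) + q * (r / 2 - y) + (r / 2 - z)) => m1.
move: (p * (r / 2 - y) - q * (r / 2 - x)) => m2 f1 g1 f2 g2.
have e2 : c1.1.2 = c2.1.2.
  apply/val_inj/(@nat_spacing _ (4 * K ^+ 2)); first by move: K20; clear; lra.
  move: f1 f2 K20; clear; rewrite ler_norml ltr_norml; rewrite ler_norml; lra.
have e3 : c1.2 = c2.2.
  have Kt : 0 < K ^+ 2 * Num.sqrt r by rewrite mulr_gt0// (lt_le_trans _ K20).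
  apply/val_inj/(@nat_spacing _ (5 * K ^+ 2 * Num.sqrt r)).
    by move: Kt; clear; lra.
  move: g1 g2 Kt; clear; rewrite ler_norml ltr_norml; rewrite ler_norml; lra.
by move: c1 c2 e1 e2 e3 {d1 d2 comp1 comp2 f1 f2 g1 g2} => [[i j] k] [[i' j'] k'] /= -> -> ->.
Qed.

Lemma maximal_card_ge {R : realType} (K r : R) PP :
  1 < K -> 16 <= Num.sqrt r -> maximal_incomparable K r PP ->
  r ^+ 2 <= 12 * 64 * 80 * K ^+ 5 * (#|` fset_set PP|%:R).
Proof.
move=> K1 r16 maxPP; have K1' := ltW K1.
have r0 : 0 < r by rewrite -sqrtr_gt0; lra.
have rr : r = Num.sqrt r ^+ 2 by rewrite sqr_sqrtr// ltW.
have r2 : 2 <= r by rewrite rr; move: r16; clear; nra.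
have finPP : finite_set PP := incomparable_finite K1 r2 maxPP.1.
have rep (c : ref_index K r) :
    {w' | PP w' /\ ~ incomparable K 1 r w' (ref_plank c)}.
  apply: cid; have [w' ? ?] := maximal_comparable K1 r0 maxPP (ref_plank_in_box c K1' r16).
  by exists w'.
pose phi c := sval (rep c).
have phi_inj : injective phi.
  move=> c1 c2 e; have [_ h1] := svalP (rep c1); have [_ h2] := svalP (rep c2).
  by apply: (ref_planks_separated K1' r16 h1); rewrite -/(phi c1) e.
have : (#|{: ref_index K r}| <= #|` fset_set PP|)%N.
  rewrite cardT -(size_map phi); apply: uniq_leq_size.
    by rewrite map_inj_uniq// enum_uniq.
  move=> _ /mapP[c _ ->]; rewrite in_fset_set// inE.
  by have [] := svalP (rep c).
rewrite -(ler_nat R) /ref_index !card_prod !card_ord !natrM => h.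
have dim (x y : R) : 0 < y -> 0 <= x -> x / y <= (ref_dim x y)%:R.
  move=> y0 x0; have xy : 0 <= x / y by rewrite divr_ge0// ltW.
  by have /andP[_ /ltW] := truncn_itv xy.
have t0 : 0 <= Num.sqrt r by lra.
have K20 : 0 < K ^+ 2 by rewrite exprn_gt0//; lra.
have D1 := dim (Num.sqrt r) (12 * K) ltac:(lra) t0.
have D2 := dim r (64 * K ^+ 2) ltac:(lra) (ltW r0).
have D3 := dim (Num.sqrt r) (80 * K ^+ 2) ltac:(lra) t0.
have K50 : 0 < 12 * 64 * 80 * K ^+ 5.
  apply: mulr_gt0; last by apply: exprn_gt0; lra.
  by do !apply: mulr_gt0.
rewrite mulrC -ler_pdivrMr//; apply: le_trans h.
apply: (@le_trans _ _ (Num.sqrt r / (12 * K) * (r / (64 * K ^+ 2)) *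
    (Num.sqrt r / (80 * K ^+ 2)))).
  rewrite le_eqVlt; apply/orP; left; apply/eqP.
  rewrite {1}rr {3}rr; field; rewrite gt_eqF//; lra.
have P (x a : R) : 0 <= x -> 0 <= a -> 0 <= x / a by exact: divr_ge0.
have Q1 : 0 <= 12 * K by lra.
have Q2 : 0 <= 64 * K ^+ 2 by lra.
have Q3 : 0 <= 80 * K ^+ 2 by lra.
apply: ler_pM => //; [by apply: mulr_ge0; apply: P => //; exact: ltW|exact: P|].
by apply: ler_pM => //; apply: P => //; exact: ltW.
Qed.

(** * Points of the jittered grid in cubes and planks *)

Lemma npoints_codom {R : realType} (T : finType) (pt : T -> 'rV[R]_3)
    (B : set 'rV[R]_3) : injective pt ->
  npoints [fset x in codom pt]%fset B = #|[set c | pt c \in B]%SET|.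
Proof.
move=> inj; rewrite /npoints.
have -> : [fset x in [fset x in codom pt]%fset | x \in B]%fset
    = [fset x in [seq x <- codom pt | x \in B]]%fset.
  by apply/fsetP => x; rewrite !inE mem_filter andbC.
rewrite card_fseq undup_id; last first.
  by rewrite filter_uniq// /codom /image_mem map_inj_uniq// enum_uniq.
rewrite size_filter /codom /image_mem count_map -size_filter cardE.
rewrite /enum_mem -!filter_predI; congr size.
by apply: eq_filter => c; rewrite !inE /= andbT.
Qed.

(** A coordinate of a difference is its inner product with a column of [M]; columns are unit
    vectors, so their absolute sum is at most sqrt 3 <= 2. *)
Lemma is_cube_diam {R : realType} (rho : R) Q x y i : 0 <= rho -> is_cube rho Q ->
  Q x -> Q y -> (i < 3)%N -> `|entry x i - entry y i| <= 2 * rho.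
Proof.
move=> rho0 [v [M [MM ->]]] [t bt <-] [u bu <-] i3.
rewrite -entryB opprD addrACA subrr add0r -mulmxBl.
have MM' := mulmx1C MM.
pose j : 'I_3 := inord i.
have : (M^T *m M) j j = 1 by rewrite MM' mxE eqxx.
rewrite mxE !big_ord_recl big_ord0 addr0 !mxE => h.
rewrite /entry -/j mxE !big_ord_recl big_ord0 addr0.
have bnd k : `|(t - u) 0 k| <= rho.
  by rewrite !mxE ler_norml; have := bt k; have := bu k; lra.
move: (M ord0 j) (M (lift ord0 ord0) j) (M (lift ord0 (lift ord0 ord0)) j) h.
move: (bnd ord0) (bnd (lift ord0 ord0)) (bnd (lift ord0 (lift ord0 ord0))).
move: ((t - u) 0 _) ((t - u) 0 _) ((t - u) 0 _).
move=> e0 e1 e2 h0 h1 h2 a b c h.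
have abc : `|a| + `|b| + `|c| <= 2.
  have : `|a| * `|a| + (`|b| * `|b| + `|c| * `|c|) = 1.
    by rewrite -!expr2 !real_normK ?num_real// !expr2.
  have := normr_ge0 a; have := normr_ge0 b; have := normr_ge0 c.
  move: `|a| `|b| `|c| => a' b' c'; clear => c0 b0 a0 abc.
  have sq : (a' + b' + c') ^+ 2 <= 3.
    have := sqr_ge0 (a' - b'); have := sqr_ge0 (b' - c').
    by have := sqr_ge0 (a' - c'); lra.
  by nra.
apply: le_trans (ler_normD _ _) _; apply: le_trans (lerD (lexx _) (ler_normD _ _)) _.
rewrite !normrM; apply: (@le_trans _ _ (rho * (`|a| + `|b| + `|c|))).
  by rewrite -addrA !mulrDr; apply: lerD; [|apply: lerD]; apply: ler_wpM2r.
by rewrite mulrC; apply: ler_wpM2r.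
Qed.

Definition jitter_point {R : realType} n M (s d : R)
    (f : {ffun 'I_n * 'I_n * 'I_n -> 'I_M.+1}) (c : 'I_n * 'I_n * 'I_n) :
    'rV[R]_3 :=
  vec3 (s * c.1.1%:R) (s * c.1.2%:R) (d * (c.2 * M.+1 + f c)%:R).

Lemma nat_dist_le {R : realType} (s D : R) (m1 m2 : nat) : 0 < s -> 0 <= D ->
  s * m1%:R - s * m2%:R <= D -> (m1 <= m2 + Num.truncn (D / s))%N.
Proof.
move=> s0 D0 h; rewrite leqNgt; apply/negP => lt.
have Ds : 0 <= D / s by rewrite divr_ge0// ltW.
have /andP[_] := truncn_itv Ds; rewrite ltr_pdivrMr// -natr1 => h2.
have : m2%:R + (Num.truncn (D / s))%:R + 1 <= m1%:R :> R.
  by rewrite -natrD natr1 ler_nat.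
by move=> /(ler_wpM2l (ltW s0)); lra.
Qed.

(** Horizontal coordinates are exact multiples of [s], so at most D / s + 1 cell indices occur; the
    height moves by less than [s] inside its cell, which costs one more vertical index. *)
Lemma jitter_point_count {R : realType} n M (s d D : R)
    (f : {ffun 'I_n * 'I_n * 'I_n -> 'I_M.+1}) (Q : set 'rV[R]_3) :
  0 < s -> s = d * M.+1%:R -> 0 <= D ->
  (forall x y i, Q x -> Q y -> (i < 3)%N -> entry x i - entry y i <= D) ->
  #|[set c | jitter_point s d f c \in Q]%SET|%:R <= (D / s + 2) ^+ 3 :> R.
Proof.
move=> s0 sd D0 diam; set S := [set c | _]%SET.
pose S1 := [set c.1.1 | c in S]%SET; pose S2 := [set c.1.2 | c in S]%SET.
pose S3 := [set c.2 | c in S]%SET; pose E := Num.truncn (D / s).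
have Ds : 0 <= D / s by rewrite divr_ge0// ltW.
have d0 : 0 < d by move: s0; rewrite sd pmulr_lgt0.
have ent (c : 'I_n * 'I_n * 'I_n) :=
  vec3E (s * c.1.1%:R) (s * c.1.2%:R) (d * (c.2 * M.+1 + f c)%:R).
have c1 : (#|S1| <= E.+1)%N.
  apply: card_ord_diam => _ _ /imsetP[a + ->] /imsetP[b + ->].
  rewrite !inE => Qa Qb; apply: nat_dist_le => //.
  have := diam _ _ 0%N Qa Qb isT.
  by have [-> _ _] := ent a; have [-> _ _] := ent b.
have c2 : (#|S2| <= E.+1)%N.
  apply: card_ord_diam => _ _ /imsetP[a + ->] /imsetP[b + ->].
  rewrite !inE => Qa Qb; apply: nat_dist_le => //.
  have := diam _ _ 1%N Qa Qb isT.
  by have [_ -> _] := ent a; have [_ -> _] := ent b.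
have c3 : (#|S3| <= E.+2)%N.
  have -> : E.+1 = Num.truncn ((D + s) / s).
    rewrite mulrDl divff ?gt_eqF//.
    have /andP[h1 h2] := truncn_itv Ds.
    by apply/esym/truncn_def; rewrite -!natr1 in h2 *; apply/andP; split; lra.
  apply: card_ord_diam => _ _ /imsetP[a + ->] /imsetP[b + ->].
  rewrite !inE => Qa Qb; apply: nat_dist_le => //; first lra.
  have := diam _ _ 2%N Qa Qb isT.
  have [_ _ ->] := ent a; have [_ _ ->] := ent b.
  rewrite !natrD !natrM.
  have fb : (f b)%:R <= M.+1%:R :> R by rewrite ler_nat ltnW.
  have := ler_wpM2l (ltW d0) fb; rewrite -sd.
  have : 0 <= d * (f a)%:R by rewrite mulr_ge0// ltW.
  rewrite !mulrDr ![d * (_ * _)]mulrCA -sd; lra.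
have SX : S \subset finset.setX (finset.setX S1 S2) S3.
  apply/fintype.subsetP => c Sc; rewrite !inE.
  by rewrite !(imset_f (fun c : 'I_n * 'I_n * 'I_n => _)).
have := subset_leq_card SX; rewrite !cardsX => h.
have EE : E%:R <= D / s by have /andP[] := truncn_itv Ds.
apply: (@le_trans _ _ (E.+2 ^ 3)%:R).
  rewrite ler_nat; apply: leq_trans h _; rewrite !expnS expn0 muln1 mulnA.
  by do 2 (apply: leq_mul => //); apply: leq_trans (leqnSn _).
rewrite natrX; apply: lerXn2r; rewrite ?nnegrE//; first lra.
by rewrite -addn2 natrD lerD2r.
Qed.

Lemma jitter_point_inj {R : realType} n M (s d : R)
    (f : {ffun 'I_n * 'I_n * 'I_n -> 'I_M.+1}) : 0 < s -> 0 < d ->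
  injective (jitter_point s d f).
Proof.
move=> s0 d0 c c' e.
have ent (c : 'I_n * 'I_n * 'I_n) :=
  vec3E (s * c.1.1%:R) (s * c.1.2%:R) (d * (c.2 * M.+1 + f c)%:R).
have [a0 a1 a2] := ent c; have [b0 b1 b2] := ent c'.
have cancel_nat (a : R) (m m' : nat) : 0 < a -> a * m%:R = a * m'%:R -> m = m'.
  move=> ap /(mulfI (lt0r_neq0 ap)) /eqP; rewrite eqr_nat => /eqP //.
have e0 : c.1.1 = c'.1.1.
  by apply/val_inj/(cancel_nat s) => //; rewrite -a0 -b0 [vec3 _ _ _]e.
have e1 : c.1.2 = c'.1.2.
  by apply/val_inj/(cancel_nat s) => //; rewrite -a1 -b1 [vec3 _ _ _]e.
have e2 : c.2 = c'.2.
  have : (c.2 * M.+1 + f c)%N = (c'.2 * M.+1 + f c')%N.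
    by apply/(cancel_nat d) => //; rewrite -a2 -b2 [vec3 _ _ _]e.
  move/(congr1 (divn^~ M.+1)).
  by rewrite !divnMDl// !divn_small// !addn0 => /val_inj.
by move: c c' {e a0 a1 a2 b0 b1 b2} e0 e1 e2 => [[i j] k] [[i' j'] k'] /= -> -> ->.
Qed.

Lemma jitter_point_box {R : realType} n M (r s d : R)
    (f : {ffun 'I_n * 'I_n * 'I_n -> 'I_M.+1}) c : 0 < s -> 0 < d ->
  r = s * n%:R -> s = d * M.+1%:R -> box r (jitter_point s d f c).
Proof.
move=> s0 d0 rs sd; apply/box_in_cube; rewrite at_point_vec3.
have lt (i : 'I_n) : 0 <= s * i%:R <= r.
  rewrite mulr_ge0 ?(ltW s0)//= rs; apply: ler_wpM2l; first exact: ltW.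
  by rewrite ler_nat ltnW.
split => //; rewrite mulr_ge0 ?(ltW d0)//= rs sd -mulrA -natrM.
apply: ler_wpM2l; first exact: ltW.
rewrite ler_nat; apply: (@leq_trans (c.2.+1 * M.+1)).
  by rewrite mulSn addnC leq_add2r ltnW.
by rewrite mulnC leq_mul2l ltn_ord orbT.
Qed.

Lemma card_codom_fset {R : realType} n M (s d : R)
    (f : {ffun 'I_n * 'I_n * 'I_n -> 'I_M.+1}) : 0 < s -> 0 < d ->
  #|` [fset x in codom (jitter_point s d f)]%fset| = (n ^ 3)%N.
Proof.
move=> s0 d0; rewrite card_fseq undup_id.
  by rewrite size_codom !card_prod !card_ord !expnS expn0 muln1 mulnA.
by rewrite /codom /image_mem map_inj_uniq ?enum_uniq//; exact: jitter_point_inj.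
Qed.

Lemma npoints_jittered {R : realType} n M (r s d : R)
    (f : {ffun 'I_n * 'I_n * 'I_n -> 'I_M.+1}) w : 0 < r -> 0 < s -> 0 < d ->
  (npoints [fset x in codom (jitter_point s d f)]%fset (lightplank 1 r w))%:R
  = \sum_c (jittered s d f c (cplank r 1 w))%:R :> R.
Proof.
move=> r0 s0 d0; rewrite npoints_codom; last exact: jitter_point_inj.
rewrite sum_indic; congr (_%:R); apply: eq_card => c; rewrite !finset.inE.
apply/idP/asboolP => [/set_mem/(lightplank_cplank _ _ r0)|h].
  by rewrite at_point_vec3.
by apply/mem_set/lightplank_cplank => //; rewrite at_point_vec3.
Qed.

(** Here [g] stands for r^(eps / 3), and the cell side lies between 4 rho / g and 8 rho / g: a
    [rho]-cube then holds at most (g / 2 + 2)^3 <= g^3 points, while a plank expects about T of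
    them. *)
Lemma exists_points {R : realType} (r rho g : R) (Y := r * g / rho)
    (T := r * Num.sqrt r * (g / rho) ^+ 3) :
  16 <= Num.sqrt r -> 64 <= g -> 0 < rho -> rho <= Num.sqrt r ->
  25 ^+ 5 * r ^+ 10 * (2 * expR (- (g ^+ 3 / 2 ^+ 22))) < 1 ->
  exists X : {fset 'rV[R]_3},
    [/\ forall x, x \in X -> box r x,
      Y ^+ 3 / 512 <= #|` X|%:R <= Y ^+ 3 / 64,
      forall Q, is_cube rho Q -> (npoints X Q)%:R <= g ^+ 3 &
      forall w, cplank_in_cube r w ->
        T / 2 ^+ 22 <= (npoints X (lightplank 1 r w))%:R <= 7 * T].
Proof.
move=> r16 g64 rho0 rhor small.
have r0 : 0 < r by rewrite -sqrtr_gt0; lra.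
have rr : r = Num.sqrt r ^+ 2 by rewrite sqr_sqrtr// ltW.
have t0 : 0 < Num.sqrt r by lra.
have g0 : 0 < g by lra.
pose h := rho / g; have h0 : 0 < h by rewrite divr_gt0.
have Y1 : 1 <= r / (4 * h).
  rewrite ler_pdivlMr; last by lra.
  rewrite mul1r /h mulrA ler_pdivrMr// rr; move: r16 g64 rho0 rhor; clear.
  move: (Num.sqrt r) => t; nra.
(* An integer number of cells must fill the cube exactly; as n + 1 <= 2 n, rounding at most doubles
   the side 4 h. *)
pose n := Num.truncn (r / (4 * h)).
have /andP[n1 n2] := truncn_itv (le_trans ler01 Y1); rewrite -/n in n1 n2.
have n0 : (0 < n)%N.
  rewrite lt0n; apply/eqP => nz; move: n2; rewrite nz; lra.
have nR : 1 <= n%:R :> R by rewrite (ler_nat _ 1).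
have nn : n%:R != 0 :> R by rewrite pnatr_eq0 -lt0n.
pose s := r / n%:R.
have rs : r = s * n%:R by rewrite /s divfK.
have s0 : 0 < s by rewrite divr_gt0//; lra.
have h40 : 0 < 4 * h by lra.
have s4 : 4 * h <= s.
  rewrite /s ler_pdivlMr; last lra.
  by move: n1; rewrite ler_pdivlMr// mulrC.
have s8 : s <= 8 * h.
  rewrite /s ler_pdivrMr; last lra.
  move: n2; rewrite ltr_pdivrMr// -natr1 => /ltW n2.
  apply: le_trans n2 _.
  have : h * 1 <= h * n%:R by apply: ler_wpM2l => //; exact: ltW.
  by lra.
have hg : h * g = rho by rewrite /h divfK// gt_eqF.
have sr : s <= Num.sqrt r / 8.
  apply: le_trans s8 _.
  have : h * 64 <= h * g by apply: ler_wpM2l => //; exact: ltW.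
  by lra.
(* Enough heights per cell that [d <= 1 / 4], the half-length of the inner vertical fibres. *)
pose M := Num.truncn (4 * s).
have s40 : 0 <= 4 * s by lra.
have /andP[_ M2] := truncn_itv s40; rewrite -/M in M2.
have M0 : 0 < M.+1%:R :> R by [].
pose d := s / M.+1%:R.
have d0 : 0 < d by rewrite divr_gt0.
have sd : s = d * M.+1%:R by rewrite /d divfK// gt_eqF.
have d4 : d <= 1 / 4 by rewrite /d ler_pdivrMr//; lra.
pose L := Num.truncn (24 * r ^+ 2).
have r20 : 0 <= 24 * r ^+ 2 by rewrite mulr_ge0// sqr_ge0.
have /andP[L1 L2] := truncn_itv r20; rewrite -/L in L1 L2.
have L25 : L.+1%:R <= 25 * r ^+ 2.
  rewrite -natr1; have : 1 <= r ^+ 2.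
    apply: exprn_ege1; rewrite rr; move: r16; clear; nra.
  by lra.
have T0 : 0 < r * Num.sqrt r by rewrite mulr_gt0.
have s30 : 0 < s ^+ 3 by rewrite exprn_gt0.
have h30 : 0 < h ^+ 3 by rewrite exprn_gt0.
have TE : T = r * Num.sqrt r / h ^+ 3.
  by rewrite /T /h; field; rewrite !gt_eqF.
have h80 : 0 < 8 * h by lra.
have s38 : s ^+ 3 <= 8 ^+ 3 * h ^+ 3.
  by rewrite -exprMn; apply: lerXn2r; rewrite ?nnegrE//; exact: ltW.
have s34 : 4 ^+ 3 * h ^+ 3 <= s ^+ 3.
  by rewrite -exprMn; apply: lerXn2r; rewrite ?nnegrE//; exact: ltW.
pose a := r * Num.sqrt r / (2048 * s ^+ 3).
pose b := 108 * (r * Num.sqrt r) / s ^+ 3.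
(* The exponent 22 comes from 2048 * 4 = 2^13 and from s^3 <= 8^3 h^3 with 8^3 = 2^9. *)
have aT : T / 2 ^+ 22 <= a / 4.
  rewrite TE /a.
  rewrite (_ : r * Num.sqrt r / (2048 * s ^+ 3) / 4 =
    r * Num.sqrt r / (2 ^+ 13 * s ^+ 3)); last by field; rewrite gt_eqF.
  rewrite -mulrA -invfM ler_pM2l// lef_pV2 ?posrE; last 2 first.
  - by rewrite mulr_gt0// exprn_gt0.
  - by rewrite mulr_gt0// exprn_gt0.
  rewrite (_ : h ^+ 3 * 2 ^+ 22 = 2 ^+ 13 * (8 ^+ 3 * h ^+ 3)); last by ring.
  by apply: ler_wpM2l.
have bT : 4 * b <= 7 * T.
  rewrite TE /b.
  have : r * Num.sqrt r / s ^+ 3 <= r * Num.sqrt r / (4 ^+ 3 * h ^+ 3).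
    rewrite ler_pM2l// lef_pV2 ?posrE// mulr_gt0//.
  have : 0 < r * Num.sqrt r / h ^+ 3 by rewrite divr_gt0.
  rewrite invfM; clear; lra.
(* Since rho^3 <= r^(3/2), even the largest [rho] leaves about r^eps points per plank, which drives
   the failure bound. *)
have Tg : g ^+ 3 <= T.
  rewrite /T expr_div_n mulrA ler_pdivlMr ?exprn_gt0// mulrC.
  rewrite ler_pM2r ?exprn_gt0// {1}rr -exprSr lerXn2r// nnegrE; exact: ltW.
have ab : a / 4 <= b.
  have : 0 < r * Num.sqrt r / s ^+ 3 by rewrite divr_gt0.
  rewrite /a /b invfM; clear; lra.
have ag : g ^+ 3 / 2 ^+ 22 <= a / 4.
  by apply: le_trans aT; rewrite ler_pM2r// invr_gt0 exprn_gt0.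
have fin : L.+1%:R ^+ 5 * (expR (- (a / 4)) + expR (- b)) < 1.
  apply: le_lt_trans small.
  apply: ler_pM; rewrite ?exprn_ge0// ?addr_ge0 ?expR_ge0//.
    rewrite (_ : 25 ^+ 5 * r ^+ 10 = (25 * r ^+ 2) ^+ 5); last by ring.
    have r250 : 0 <= 25 * r ^+ 2 by rewrite mulr_ge0// sqr_ge0.
    by apply: lerXn2r; rewrite ?nnegrE.
  set e := expR (- (g ^+ 3 / _)); rewrite (_ : 2 * e = e + e); last by ring.
  apply: lerD; rewrite ler_expR lerN2 => //; exact: le_trans ag ab.
have [f hf] := exists_jitter r16 rs sd s0 sr d0 d4 L2 fin.
exists [fset x in codom (jitter_point s d f)]%fset; split.
- move=> x; rewrite !inE => /codomP[c ->].
  exact: (jitter_point_box _ _ s0 d0 rs sd).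
- rewrite card_codom_fset// natrX.
  have Yn : Y = 4 * (r / (4 * h)) by rewrite /Y /h; field; rewrite !gt_eqF.
  set y := r / (4 * h) in Yn n1 n2 Y1.
  have {}n2 : y < n%:R + 1 by rewrite natr1.
  rewrite Yn; apply/andP; split.
    rewrite (_ : _ / _ = (y / 2) ^+ 3); last by field.
    by apply: lerXn2r; rewrite ?nnegrE//; move: n2 Y1 nR; clear; lra.
  rewrite (_ : _ / _ = y ^+ 3); last by field.
  by apply: lerXn2r; rewrite ?nnegrE//; move: Y1; clear; lra.
- move=> Q cQ; rewrite npoints_codom; last exact: jitter_point_inj.
  apply: (@le_trans _ _ ((2 * rho / s + 2) ^+ 3)).
    apply: jitter_point_count => //; first by apply: mulr_ge0 => //; exact: ltW.
    move=> x y i Qx Qy i3; apply: le_trans (ler_norm _) _.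
    by apply: (is_cube_diam _ cQ) => //; exact: ltW.
  have : 2 * rho / s <= g / 2.
    rewrite ler_pdivrMr// -hg.
    have : g * (4 * h) <= g * s by apply: ler_wpM2l => //; exact: ltW.
    by clear; lra.
  have : 0 <= 2 * rho / s by apply: divr_ge0; [move: rho0; clear; lra|exact: ltW].
  move=> e1 e2; apply: lerXn2r; rewrite ?nnegrE; last first.
  - by move: e1 e2 g64; clear; lra.
  - exact: ltW.
  - by move: e1; clear; lra.
- move=> w cw; rewrite npoints_jittered//.
  have /andP[z1 z2] := hf _ cw.
  by rewrite (le_trans aT z1) (le_trans z2 bT).
Qed.

(** * Powers of [r] and the final inequality *)

(** One term of the exponential series, of order k + 1 >= 11 / eps, already exceeds a constant times
    r^11; the spare factor [r] beats the constant [B]. *)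
Lemma exp_beats_power {R : realType} (eps : R) : 0 < eps ->
  exists R0 : R, 0 < R0 /\ forall r, R0 <= r ->
    [/\ 16 <= Num.sqrt r, 64 <= r `^ (eps / 3) &
    25 ^+ 5 * r ^+ 10 * (2 * expR (- (r `^ eps / 2 ^+ 22))) < 1].
Proof.
move=> eps0.
pose k := Num.truncn (11 / eps).
have e11 : 0 <= 11 / eps by rewrite divr_ge0// ltW.
have k11 : 11 <= eps * k.+1%:R.
  have /andP[_ /ltW] := truncn_itv e11.
  by rewrite ler_pdivrMr// mulrC.
pose A : R := 2 ^+ 22; have A0 : 0 < A by rewrite exprn_gt0.
pose F : R := k.+1`!%:R; have F0 : 0 < F by rewrite ltr0n fact_gt0.
pose B := 25 ^+ 5 * 2 * (A ^+ k.+1 * F).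
have B0 : 0 < B by rewrite !mulr_gt0 ?exprn_gt0.
have P0 := powR_ge0 (64 : R) (3 / eps).
(* The first three summands serve the three requirements in turn. *)
exists (16 ^+ 2 + 64 `^ (3 / eps) + B + 1); split.
  by rewrite ltr_wpDl// addr_ge0 ?(ltW B0)// addr_ge0// exprn_ge0.
move=> r hr.
have c256 : (1 : R) <= 16 ^+ 2 by rewrite exprn_ege1// ler1n.
have r1 : 1 <= r by lra.
have r0 : 0 < r by lra.
have r256 : 16 ^+ 2 <= r by lra.
have r64 : 64 `^ (3 / eps) <= r by lra.
have rB : B < r by lra.
split.
- by rewrite -(@ger0_norm _ 16)// -sqrtr_sqr ler_wsqrtr.
- have -> : 64 = (64 `^ (3 / eps)) `^ (eps / 3) :> R.
    rewrite -powRrM (_ : 3 / eps * (eps / 3) = 1) ?powRr1//.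
    by field; rewrite gt_eqF.
  apply: ge0_ler_powR; rewrite ?nnegrE//; last exact: ltW.
  by rewrite divr_ge0// ltW.
- set y := r `^ eps.
  have y0 : 0 <= y := powR_ge0 _ _.
  have yk : r ^+ 11 <= y ^+ k.+1.
    by rewrite /y -powR_mulrn ?powR_ge0// -powRrM -powR_mulrn ?(ltW r0)// ler_powR.
  have ex : r ^+ 11 / (A ^+ k.+1 * F) <= expR (y / A).
    have := @expR_ge1Dxn R (y / A) k (divr_ge0 y0 (ltW A0)).
    have : r ^+ 11 / (A ^+ k.+1 * F) <= (y / A) ^+ k.+1 / F.
      rewrite invfM mulrA expr_div_n; apply: ler_wpM2r; first by rewrite invr_ge0 ltW.
      by apply: ler_wpM2r => //; rewrite invr_ge0 exprn_ge0// ltW.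
    by rewrite -/F; lra.
  have AF0 : 0 < A ^+ k.+1 * F by rewrite mulr_gt0// exprn_gt0.
  rewrite expRN mulrA ltr_pdivrMr ?expR_gt0// mul1r.
  apply: lt_le_trans ex; rewrite ltr_pdivlMr//.
  rewrite [ltLHS](_ : _ = B * r ^+ 10); last by rewrite /B; ring.
  by rewrite (exprS r 10) ltr_pM2r// exprn_gt0.
Qed.

Lemma powR_density {R : realType} (r rho eps : R) : 0 < r -> 0 < rho ->
  r `^ (3 + eps) * rho `^ (- 3) = (r * r `^ (eps / 3) / rho) ^+ 3 /\
  r `^ (3 / 2 + eps) * rho `^ (- 3) =
    r * Num.sqrt r * (r `^ (eps / 3) / rho) ^+ 3.
Proof.
move=> r0 rho0; have rn : r != 0 by rewrite gt_eqF.
have ge : (r `^ (eps / 3)) ^+ 3 = r `^ eps.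
  by rewrite -powR_mulrn ?powR_ge0// -powRrM; congr (_ `^ _); field.
have hr : r `^ (3 / 2) = r * Num.sqrt r.
  rewrite -powR12_sqrt; last exact: ltW.
  rewrite -{2}[r]powRr1; last exact: ltW.
  rewrite -powRD; last by rewrite rn implybT.
  by congr (_ `^ _); field.
have D x : r `^ (x + eps) = r `^ x * r `^ eps by rewrite powRD// rn implybT.
have r3 : r `^ 3 = r ^+ 3 by rewrite -powR_mulrn// ltW.
have rho3 : rho `^ 3 = rho ^+ 3 by rewrite -powR_mulrn// ltW.
rewrite !D powRN r3 rho3 hr -ge !expr_div_n exprMn.
by split; rewrite -?mulrA.
Qed.

Theorem theorem4p1 (R : realType) :
  exists C : R, 0 < C /\
  forall K : R, 1 < K ->
  exists Ceta : R -> R,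
  forall eps : R, 0 < eps ->
  exists R0 : R, 0 < R0 /\
  forall r : R, R0 <= r ->
  forall rho : R, r `^ eps <= rho -> rho <= r `^ (1 / 2) ->
  exists (d : measure_display) (Omega : measurableType d)
         (P : probability Omega R) (X : Omega -> {fset 'rV[R]_3}),
    random_set X /\
    (forall w x, x \in X w -> box r x) /\
    with_prob_at_least P (9 / 10) [set w |
      comparable_up_to C (#|` X w|%:R) (r `^ (3 + eps) * rho `^ (- 3)) /\
      (forall Q : set 'rV[R]_3, is_cube rho Q ->
         (npoints (X w) Q)%:R <= r `^ eps) /\
      (forall PP : set ('rV[R]_3 * R), maximal_incomparable K r PP ->
         (forall p, PP p ->
            comparable_up_to C ((npoints (X w) (lightplank 1 r p))%:R)
              (r `^ (3 / 2 + eps) * rho `^ (- 3))) /\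
         finite_set PP /\
         (forall eta : R, 0 < eta ->
            (#|` X w|%:R) `^ (4 / 3) <=
            Ceta eta * r `^ eta *
            ((r `^ (3 / 2 + eps) * rho `^ (- 3)) `^ (4 / 3) *
             (#|` fset_set PP|%:R))))].
Proof.
have C512 : (512 : R) <= 2 ^+ 22.
  have -> : 512 = 2 ^+ 9 :> R by rewrite -natrX.
  by rewrite ler_eXn2l// ltr1n.
exists (2 ^+ 22); split; first by rewrite exprn_gt0.
(* The number of planks is at least r^2 divided by this constant; then r^eta >= 1 is enough for
   every [eta]. *)
move=> K K1; exists (fun=> 12 * 64 * 80 * K ^+ 5) => eps eps0.
have [R0 [R00 hR0]] := exp_beats_power eps0.
exists R0; split=> // r Rr rho rho1 rho2.
have [r16 g64 small] := hR0 _ Rr.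
have r0 : 0 < r by apply: lt_le_trans Rr.
have rho0 : 0 < rho by apply: lt_le_trans rho1; rewrite powR_gt0.
have rhor : rho <= Num.sqrt r by move: rho2; rewrite div1r powR12_sqrt// ltW.
have g3 : (r `^ (eps / 3)) ^+ 3 = r `^ eps.
  by rewrite -powR_mulrn ?powR_ge0// -powRrM; congr (_ `^ _); field.
have [E1 E2] := powR_density eps r0 rho0.
rewrite E1 E2.
move: small; rewrite -g3 => small.
have [X [Xbox Xcard Xcube Xplank]] := exists_points r16 g64 rho0 rhor small.
(* On a one-point space the constant random set is measurable and the event has probability 1. *)
exists _, unit, (dirac tt : probability _ R), (fun=> X).
split.
  move=> B _ k; case: (pselect (npoints X B = k)) => h.
    rewrite (_ : [set w | _] = setT) //; apply/seteqP; split => //.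
  rewrite (_ : [set w | _] = set0) //; apply/seteqP; split => //.
split; first by move=> _ x; exact: Xbox.
exists setT; split => //; first by rewrite probability_setT lee_fin; lra.
set g := r `^ (eps / 3) in g64 g3 Xcard Xcube Xplank *.
set T := r * Num.sqrt r * (g / rho) ^+ 3 in Xplank *.
have g0 : 0 < g by lra.
have Y0 : 0 < r * g / rho by rewrite divr_gt0// mulr_gt0.
have T0 : 0 < T.
  by apply: mulr_gt0; [rewrite mulr_gt0 ?sqrtr_gt0|rewrite exprn_gt0 ?divr_gt0].
have /andP[card1 card2] := Xcard.
have C0 : (0 : R) < 2 ^+ 22 by rewrite exprn_gt0.
move=> _ _ /=; split; [|split => //].
  have Y30 : 0 < (r * g / rho) ^+ 3 by rewrite exprn_gt0.
  apply/andP; split.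
    apply: le_trans card1; rewrite mulrC ler_pM2l//.
    by rewrite lef_pV2 ?posrE ?ltr0n.
  apply: le_trans card2 _; rewrite mulrC ler_pM2r//; lra.
move=> PP maxPP; split; [|split].
- move=> p Pp; have [[inbox _] _] := maxPP.
  have [_ /(lightplank_sub_box _ r0)/Xplank/andP[p1 p2]] := inbox _ Pp.
  apply/andP; split; first by rewrite mulrC.
  by apply: le_trans p2 _; rewrite ler_pM2r//; lra.
- apply: (incomparable_finite K1 _ maxPP.1).
  have : Num.sqrt r ^+ 2 = r by rewrite sqr_sqrtr// ltW.
  by move: r16; clear; nra.
move=> eta eta0.
have card_ge := maximal_card_ge K1 r16 maxPP.
set N : R := #|` fset_set PP|%:R in card_ge *.
have r1 : 1 <= r `^ eta.
  have : 1 <= r.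
    have : Num.sqrt r ^+ 2 = r by rewrite sqr_sqrtr// ltW.
    by move: r16; clear; nra.
  by move=> r1; rewrite -(powRr0 r) ler_powR// ltW.
have cube43 (x : R) : 0 <= x -> (x ^+ 3) `^ (4 / 3) = x ^+ 4.
  move=> x0; rewrite -[x ^+ 3]powR_mulrn// -powRrM -powR_mulrn//.
  by congr (_ `^ _); field.
(* Written as cubes, both sides become fourth powers under the exponent 4/3; their quotient is r^2,
   exactly what the number of planks supplies. *)
have TE : T = (Num.sqrt r * (g / rho)) ^+ 3.
  rewrite /T [RHS]exprMn; congr (_ * _).
  by rewrite exprSr sqr_sqrtr// ltW.
apply: (@le_trans _ _ ((r * g / rho) ^+ 4)).
  rewrite -cube43 ?(ltW Y0)//; apply: ge0_ler_powR; rewrite ?nnegrE//.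
  - by rewrite exprn_ge0// ltW.
  - apply: le_trans card2 _; rewrite ler_pdivrMr// ler_peMr ?ler1n//.
    by rewrite exprn_ge0// ltW.
have s0 : 0 <= Num.sqrt r * (g / rho) by rewrite mulr_ge0 ?sqrtr_ge0// divr_ge0// ltW.
rewrite TE cube43//.
have -> : (r * g / rho) ^+ 4 = r ^+ 2 * (Num.sqrt r * (g / rho)) ^+ 4.
  rewrite [(Num.sqrt r * _) ^+ 4]exprMn (_ : Num.sqrt r ^+ 4 = r ^+ 2).
    by field; rewrite gt_eqF.
  by rewrite -[4%N]/(2 * 2)%N exprM sqr_sqrtr// ltW.
set Z := (Num.sqrt r * (g / rho)) ^+ 4.
have Z0 : 0 <= Z by rewrite exprn_ge0.
rewrite [leRHS](_ : _ = r `^ eta * ((12 * 64 * 80 * K ^+ 5 * N) * Z)); last by ring.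
apply: (@le_trans _ _ ((12 * 64 * 80 * K ^+ 5 * N) * Z)); first exact: ler_wpM2r.
rewrite ler_peMl//; apply: mulr_ge0 => //; apply: le_trans card_ge.
exact: sqr_ge0.
Qed.
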